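(* Let $\{X; S_i, p_{ij} : 1\le i,j\le N\}$ be a hyperbolic recurrent iterated function system satisfying the strong separation condition, let $(p_1,\dots,p_N)$ be the stationary distribution associated with $[p_{ij}]_{1\le i,j\le N}$, and let $\mu$ be the probability measure generated by the system. Then $$\frac{\sum_{i=1}^N\sum_{j=1}^N p_i p_{ij}\log p_{ij}}{\sum_{i=1}^N p_i\log \underline{s}_i}\ \le\ \underline{D}(\mu)\ \le\ \overline{D}(\mu)\ \le\ \frac{\sum_{i=1}^N\sum_{j=1}^N p_i p_{ij}\log p_{ij}}{\sum_{i=1}^N p_i\log \overline{s}_i}.$$
   Context: Setting. $d$ is the metric induced by a fixed arbitrary norm on $\mathbb{R}^k$; $X\subset\mathbb{R}^k$ is nonempty and compact with $X=\mathrm{cl}(\mathrm{int}\,X)$, with the inherited metric. $N\ge 2$, and $P=[p_{ij}]_{1\le i,j\le N}$ is an irreducible row stochastic matrix: $p_{ij}\ge 0$, $\sum_j p_{ij}=1$ for all $i$, and for each pair $i,j$ there are $i_1=i,i_2,\dots,i_n=j$ with $p_{i_1i_2}p_{i_2i_3}\cdots p_{i_{n-1}i_n}>0$. The maps $S_i:X\to X$ ($1\le i\le N$) satisfy $\underline{s}_i\, d(x,y)\le d(S_i(x),S_i(y))\le \overline{s}_i\, d(x,y)$ for all $x,y\in X$, where $0<\underline{s}_i\le\overline{s}_i<1$. The collection $\{X;S_i,p_{ij}:1\le i,j\le N\}$ is called a hyperbolic recurrent iterated function system (IFS). The stationary distribution is the unique probability vector $(p_1,\dots,p_N)$, all $p_i>0$,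 with $\sum_i p_ip_{ij}=p_j$ for all $j$. Convention: $0\log 0=0$. Measure generated by the system. There are unique nonempty compact sets $E_1,\dots,E_N\subset X$ with $E_i=\bigcup_{\{j:\,p_{ji}>0\}}S_i(E_j)$ for all $i$; put $E=\bigcup_i E_i$. Let $\Omega=\{\omega=(\omega_i)_{i\ge1}: 1\le\omega_i\le N,\ p_{\omega_{i+1}\omega_i}>0 \text{ for all } i\ge 1\}$ with the topology generated by cylinders, and let $\nu$ be the unique Borel probability measure on $\Omega$ with $\nu(\{\tau\in\Omega:\tau_i=\omega_i,\ 1\le i\le n\})=p_{\omega_n}p_{\omega_n\omega_{n-1}}\cdots p_{\omega_2\omega_1}$ for every admissible word $(\omega_1,\dots,\omega_n)$. The coding map $\pi:\Omega\to E$ sends $\omega$ to the unique point of $\bigcap_{n\ge2}S_{\omega_1}\circ\cdots\circ S_{\omega_{n-1}}(E_{\omega_n})$. The measure generated by the system is $\mu=\nu\circ\pi^{-1}$, regarded as a Borel probability measure on $\mathbb{R}^k$. Strong separation condition: $d(S_i(E_k),S_j(E_\ell))>0$ for all $1\le i,j,k,\ell\le N$ with $(k,i)\neq(\ell,j)$ and $p_{ki}p_{\ell j}>0$. Quantization. For a Borel probability measure $\mu$ on $\mathbb{R}^k$ and $n\in\mathbb{N}$, $\hat e_n(\mu)=\inf\{\int\log d(x,\alpha)\,d\mu(x):\alpha\subset\mathbb{R}^k,\ 1\le\mathrm{card}(\alpha)\le n\}$, where $d(x,\alpha)$ is the distance from $x$ to $\alpha$. The lower and upper quantization dimensions (of order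 zero) are $\underline{D}(\mu)=\liminf_{n\to\infty}\frac{\log n}{-\hat e_n(\mu)}$ and $\overline{D}(\mu)=\limsup_{n\to\infty}\frac{\log n}{-\hat e_n(\mu)}$. *)

(* Defs.v *)
From HB Require Import structures.
From mathcomp Require Import all_boot all_order all_algebra.
From mathcomp Require Import all_classical all_reals all_analysis.

Set Implicit Arguments.
Unset Strict Implicit.
Unset Printing Implicit Defensive.

Import Order.TTheory GRing.Theory Num.Theory.
Import numFieldNormedType.Exports.

Local Open Scope classical_set_scope.
Local Open Scope ring_scope.

Definition borel (T : ptopologicalType) := g_sigma_algebraType (@open T).

Section norm_metric.
Variables (R : realType) (k : nat).
Implicit Types (nrm : 'rV[R]_k -> R) (A B : set 'rV[R]_k).

(* An arbitrary norm on R^k, given by its axioms; it need not be the canonical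
   (supremum) norm of 'rV[R]_k. All norms on R^k being equivalent, the
   canonical topology of 'rV[R]_k is used for open sets, compactness, etc. *)
Definition is_norm nrm : Prop :=
  [/\ forall x y, nrm (x + y) <= nrm x + nrm y,
      forall (a : R) x, nrm (a *: x) = `|a| * nrm x &
      forall x, nrm x = 0 -> x = 0].

Definition metric nrm (x y : 'rV[R]_k) : R := nrm (x - y).

Definition dist_pt_set nrm x A : R := inf [set metric nrm x a | a in A].

Definition dist_sets nrm A B : R :=
  inf [set metric nrm a b | a in A & b in B].

End norm_metric.

(* Irreducible row stochastic matrices of order N >= 2. They are bundled so
   that the code space below is nonempty, as required of a measurableType. *)
Record irr_stochastic (R : realType) (N : nat) := IrrStochastic {
  tmat :> 'M[R]_N ;
  order_ge2 : (2 <= N)%N ;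
  tmat_ge0 : forall i j, 0 <= tmat i j ;
  tmat_sum1 : forall i, \sum_(j < N) tmat i j = 1 ;
  tmat_irr : forall i j, exists (n : nat) (w : nat -> 'I_N),
    [/\ w 0 = i, w n.+1 = j & 0 < \prod_(l < n.+1) tmat (w l) (w l.+1)]
}.

Definition stationary (R : realType) (N : nat) (P : irr_stochastic R N)
    (p : 'I_N -> R) : Prop :=
  [/\ forall i, 0 < p i, \sum_(i < N) p i = 1 &
      forall j, \sum_(i < N) p i * P i j = p j].

Section code_space.
Variables (R : realType) (N : nat) (P : irr_stochastic R N).

(* Sequences are indexed from 0: omega_(i+1) of the usual notation is w i. *)
Definition admissible (w : nat -> 'I_N) : Prop :=
  forall i, 0 < P (w i.+1) (w i).

Definition Omega := {w : nat -> 'I_N | `[< admissible w >]}.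

HB.instance Definition _ := gen_eqMixin Omega.
HB.instance Definition _ := gen_choiceMixin Omega.

Lemma tmat_pred i : exists j, 0 < P j i.
Proof.
have [n [w [_ wi]]] := tmat_irr P i i.
rewrite big_ord_recr /= wi => Pw; exists (w n).
rewrite lt_neqAle tmat_ge0 andbT eq_sym.
by apply: contraTneq Pw => ->; rewrite mulr0 ltxx.
Qed.

Lemma admissible_ex : exists w : nat -> 'I_N, `[< admissible w >].
Proof.
have [f fP] := choice tmat_pred.
exists (fun n => iter n f (Ordinal (ltnW (order_ge2 P)))).
by apply/asboolP => i /=; exact: fP.
Qed.

Definition Omega_point : Omega :=
  exist _ (projT1 (cid admissible_ex)) (projT2 (cid admissible_ex)).

HB.instance Definition _ := isPointed.Build Omega Omega_point.

(* The cylinder fixing the first n coordinates to w 0, ..., w n.-1; the values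
   of w from n on are irrelevant. *)
Definition cylinder (w : nat -> 'I_N) (n : nat) : set Omega :=
  [set tau | forall i, (i < n)%N -> sval tau i = w i].

Definition cylinders : set (set Omega) :=
  [set cylinder w n.+1 | w in [set: nat -> 'I_N] & n in [set: nat]].

HB.instance Definition _ := isSubBaseTopological.Build Omega cylinders id.

Definition is_code_measure (p : 'I_N -> R)
    (nu : probability (borel Omega) R) : Prop :=
  forall (w : nat -> 'I_N) (n : nat),
    (forall i, (i < n)%N -> 0 < P (w i.+1) (w i)) ->
    nu (cylinder w n.+1) = (p (w n) * \prod_(i < n) P (w i.+1) (w i))%:E.

End code_space.

Section recurrent_ifs.
Variables (R : realType) (k N : nat).
Variables (nrm : 'rV[R]_k -> R) (P : irr_stochastic R N).
Variables (X : set 'rV[R]_k).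
(* Only the restriction of each S i to X matters. *)
Variables (S : 'I_N -> 'rV[R]_k -> 'rV[R]_k).

Definition hyperbolic_recurrent_IFS (slo shi : 'I_N -> R) : Prop :=
  [/\ [/\ X !=set0, compact X & X = closure X°],
      forall i x, X x -> X (S i x),
      forall i, [/\ 0 < slo i, slo i <= shi i & shi i < 1] &
      forall i x y, X x -> X y ->
        slo i * metric nrm x y <= metric nrm (S i x) (S i y)
          <= shi i * metric nrm x y].

Definition limit_sets (E : 'I_N -> set 'rV[R]_k) : Prop :=
  (forall i, [/\ E i !=set0, compact (E i) & E i `<=` X]) /\
  (forall i, E i = \bigcup_(j in [set j | 0 < P j i]) (S i @` E j)).

Definition strong_separation (E : 'I_N -> set 'rV[R]_k) : Prop :=
  forall i j a b : 'I_N, (a, i) != (b, j) -> 0 < P a i * P b j ->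
    0 < dist_sets nrm (S i @` E a) (S j @` E b).

(* S (w 0) \o ... \o S (w n.-1) *)
Definition S_word (w : nat -> 'I_N) (n : nat) : 'rV[R]_k -> 'rV[R]_k :=
  \big[(fun f g => f \o g)/idfun]_(i < n) S (w i).

Definition is_coding_map (E : 'I_N -> set 'rV[R]_k)
    (pi : Omega P -> 'rV[R]_k) : Prop :=
  forall w : Omega P,
    \bigcap_(n in [set n | (1 <= n)%N])
      (S_word (sval w) n @` E (sval w n)) = [set pi w].

(* The limit sets E, the code measure nu and the coding map pi are each
   uniquely determined by the properties required of them. *)
Definition generated_measure (p : 'I_N -> R) (E : 'I_N -> set 'rV[R]_k)
    (mu : probability (borel 'rV[R]_k) R) : Prop :=
  exists (nu : probability (borel (Omega P)) R) (pi : Omega P -> 'rV[R]_k),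
    [/\ is_code_measure p nu, is_coding_map E pi &
        forall A : set (borel 'rV[R]_k), measurable A ->
          mu A = nu (pi @^-1` A)].

End recurrent_ifs.

Section quantization.
Variables (R : realType) (k : nat) (nrm : 'rV[R]_k -> R).
Variables (mu : probability (borel 'rV[R]_k) R).
Local Open Scope ereal_scope.

(* lne 0 = -oo, so the integral and the infimum may be -oo. *)
Definition quant_error0 (n : nat) : \bar R :=
  ereal_inf [set \int[mu]_x lne (dist_pt_set nrm x alpha)%:E |
    alpha in [set alpha : set 'rV[R]_k | alpha !=set0 /\ (alpha #<= `I_n)%card]].

(* If the error is -oo, the quotient is 0. *)
Definition quant_ratio0 (n : nat) : \bar R :=
  (ln n%:R)%:E / (- quant_error0 n).

Definition lower_quant_dim0 : \bar R := limn_einf quant_ratio0.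

Definition upper_quant_dim0 : \bar R := limn_esup quant_ratio0.

End quantization.

(* Main.v *)
Require Import Defs.
From HB Require Import structures.
From mathcomp Require Import all_boot all_order all_algebra.
From mathcomp Require Import all_classical all_reals all_analysis.
From mathcomp Require Import measurable_realfun.
From mathcomp Require Import ring lra.

Set Implicit Arguments.
Unset Strict Implicit.
Unset Printing Implicit Defensive.

Import Order.TTheory GRing.Theory Num.Theory.
Import numFieldNormedType.Exports.

Local Open Scope classical_set_scope.
Local Open Scope ring_scope.

(* Code a point by the word (w_0, ..., w_m) of the cell
   S_(w_0) o ... o S_(w_(m-1)) (E_(w_m)) containing it. Read from right to left,
   words are paths of the stationary Markov chain (p, P), so with h the entropy
   of the chain the numbers - ln (mass of the cell) - m h form, up to a bounded
   coboundary, a martingale with bounded increments; hence outside a set of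
   exponentially small probability the mass of a cell is exp(-m(h +- eps)).
   Choosing one point in each typical cell of generation m uses at most
   exp(m(h + eps)) points and makes the logarithmic error at most
   m sum_i p_i ln shi_i up to a constant. Conversely, by strong separation a
   point of an arbitrary quantizer is close to at most one cell of each
   generation; with at most exp(m(h - eps)) points the cells close to the
   quantizer in the generations l >= m have summable total mass, so the
   logarithmic error is at least m sum_i p_i ln slo_i up to a constant. *)

(** * Finite words over the alphabet, listed by length *)

Section words.
Variables (R : realType) (N : nat).
Implicit Types (i j : 'I_N) (s w : seq 'I_N) (m : nat).

Fixpoint words m : seq (seq 'I_N) :=
  if m is m'.+1 then [seq i :: s | i <- enum 'I_N, s <- words m'] else [:: [::]].

Lemma mem_words m w : (w \in words m) = (size w == m).
Proof.
elim: m w => [|m IH] [|i s] //.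
  by apply/negbTE/allpairsP => -[[? ?] []].
rewrite /= eqSS -IH; apply/allpairsP/idP => [[[j t] /= [_ ? [_ ->]]] //|si].
by exists (i, s); split => //; rewrite mem_enum.
Qed.

Lemma uniq_words m : uniq (words m).
Proof.
elim: m => //= m IH; apply: allpairs_uniq => //; first exact: enum_uniq.
by move=> [i s] [j t] _ _ [-> ->].
Qed.

Lemma big_words m (F : seq 'I_N -> R) :
  \sum_(w <- words m.+1) F w = \sum_i \sum_(s <- words m) F (i :: s).
Proof. by rewrite /= big_allpairs_dep big_enum. Qed.

End words.

(** * The stationary Markov chain: word probabilities, additive functionals, Poisson equation,
    entropy *)

Section chain.
Variables (R : realType) (N : nat) (P : irr_stochastic R N) (p : 'I_N -> R).
Hypothesis p_stat : stationary P p.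
Implicit Types (i j : 'I_N) (s w : seq 'I_N) (m : nat) (c g : 'I_N -> R).

(* A word is read backwards in time: its head is the latest state of the chain
   with transition matrix P started from p. *)
Fixpoint wprob w : R :=
  if w is i :: w' then
    if w' is j :: _ then P j i * wprob w' else p i
  else 0.

(* The last letter does not count: it only selects the limit set to which the
   contractions indexed by the other letters are applied. *)
Fixpoint wsum c w : R :=
  if w is i :: w' then
    if w' is _ :: _ then c i + wsum c w' else 0
  else 0.

Lemma stat_gt0 i : 0 < p i. Proof. by case: p_stat. Qed.

Lemma wprob_ge0 w : 0 <= wprob w.
Proof.
elim: w => [|i [|j s] IH] //=; first exact/ltW/stat_gt0.
by rewrite mulr_ge0 ?tmat_ge0.
Qed.

Lemma wprob_cons_gt0 i j s :
  (0 < wprob [:: i, j & s]) = (0 < P j i) && (0 < wprob (j :: s)).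
Proof.
rewrite !lt_neqAle !wprob_ge0 !tmat_ge0 !andbT !(eq_sym 0) -negb_or.
by rewrite -mulf_eq0.
Qed.

(** Markov property: given the past [j :: s], the new state [i] is drawn with the law [P j i],
    whatever [s] is. *)
Lemma sum_wprob_cons m (F : seq 'I_N -> R) :
  \sum_(w <- words N m.+2) wprob w * F w =
  \sum_j \sum_(s <- words N m)
    wprob (j :: s) * \sum_i P j i * F [:: i, j & s].
Proof.
rewrite big_words; under eq_bigr do rewrite big_words.
rewrite exchange_big; apply: eq_bigr => j _.
rewrite exchange_big; apply: eq_bigr => s _.
rewrite mulr_sumr; apply: eq_bigr => i _ /=; ring.
Qed.

(** Stationarity: at every time the latest state of the chain has law [p]. *)
Lemma sum_wprob_head m g :
  \sum_j \sum_(s <- words N m) wprob (j :: s) * g j = \sum_j p j * g j.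
Proof.
elim: m g => [|m IH] g; first by apply: eq_bigr => j _; rewrite big_seq1.
transitivity (\sum_(w <- words N m.+2) wprob w * (oapp g 0 (ohead w))).
  by rewrite big_words.
rewrite sum_wprob_cons /= IH.
case: p_stat => _ _ pP.
under [LHS]eq_bigr => j _ do rewrite mulr_sumr.
rewrite exchange_big; apply: eq_bigr => i _; rewrite -[p i]pP mulr_suml.
by apply: eq_bigr => j _; rewrite mulrA.
Qed.

Lemma sum_wprob m : \sum_(w <- words N m.+1) wprob w = 1.
Proof.
rewrite big_words; have := sum_wprob_head m (fun=> 1).
case: p_stat => _ p1 _; under [in RHS]eq_bigr do rewrite mulr1.
rewrite p1 => <-; apply: eq_bigr => i _; apply: eq_bigr => s _.
by rewrite mulr1.
Qed.

(** Each transition adds the same mean by stationarity; the factor is [m] rather than [m.+1] because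
    the last letter does not count. *)
Lemma sum_wprob_wsum m c :
  \sum_(w <- words N m.+1) wprob w * wsum c w = m%:R * \sum_i p i * c i.
Proof.
elim: m => [|m IH].
  by rewrite mul0r big_words big1 // => i _; rewrite big_seq1 mulr0.
rewrite sum_wprob_cons /=.
transitivity (\sum_j \sum_(s <- words N m) wprob (j :: s) *
    (\sum_i P j i * c i)
  + \sum_(w <- words N m.+1) wprob w * wsum c w).
  rewrite big_words -big_split; apply: eq_bigr => j _.
  rewrite -big_split; apply: eq_bigr => s _ /=.
  rewrite -mulrDr; congr (_ * _).
  under eq_bigr do rewrite mulrDr.
  by rewrite big_split /= -mulr_suml tmat_sum1 mul1r.
rewrite IH -natr1 mulrDl mul1r addrC; congr (_ + _).
rewrite (sum_wprob_head m (fun j => \sum_i P j i * c i)).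
under [LHS]eq_bigr => j _ do rewrite mulr_sumr.
rewrite exchange_big; apply: eq_bigr => i _.
case: p_stat => _ _ pP; rewrite -[p i]pP mulr_suml.
by apply: eq_bigr => j _; rewrite mulrA.
Qed.

(** Minimum principle: subtract from [u] the largest multiple of [p] that leaves a nonnegative
    vector. The difference is invariant and has a zero, and irreducibility spreads this zero to all
    states. *)
Lemma invariant_unique (u : 'I_N -> R) :
  (forall j, \sum_i u i * P i j = u j) -> exists a : R, forall i, u i = a * p i.
Proof.
move=> uP.
have N0 : (0 < N)%N by rewrite (leq_trans _ (order_ge2 P)).
pose i0 := Ordinal N0.
pose im := [arg min_(i < i0) (u i / p i)]%O.
have imP i : u im / p im <= u i / p i.
  by rewrite /im; case: arg_minP => // k _ /(_ i); apply.
exists (u im / p im) => i; apply/eqP; rewrite -subr_eq0.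
pose v i := u i - u im / p im * p i.
have v0 j : 0 <= v j by rewrite subr_ge0 -ler_pdivlMr ?stat_gt0.
have vP j : \sum_i v i * P i j = v j.
  rewrite /v; set a := u im / p im.
  under eq_bigr => i' _ do rewrite mulrBl -(mulrA a).
  by rewrite sumrB uP -mulr_sumr; case: p_stat => _ _ ->.
(* Invariance writes [v j] as a sum of nonnegative terms, so zeros travel backwards along
   transitions; a path from [i] to [im] is then followed from its end. *)
have back l j : v j = 0 -> 0 < P l j -> v l = 0.
  move=> vj Plj; have /eqP := vP j; rewrite vj psumr_eq0; last first.
    by move=> q _; rewrite mulr_ge0 // tmat_ge0.
  move=> /allP /(_ l); rewrite mem_index_enum => /(_ isT).
  by rewrite mulf_eq0 (gt_eqF Plj) orbF => /eqP.
have [n [w [w0 wn wP]]] := tmat_irr P i im.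
have wp q : (q < n.+1)%N -> 0 < P (w q) (w q.+1).
  move=> qn; rewrite lt_neqAle tmat_ge0 andbT eq_sym; apply: contraTneq wP.
  by move=> h; rewrite (bigD1 (Ordinal qn)) //= h mul0r ltxx.
suff H q : (q <= n.+1)%N -> v (w (n.+1 - q)%N) = 0.
  by have := H _ (leqnn _); rewrite subnn w0 => /eqP.
elim: q => [_|q IH qn].
  by rewrite subn0 wn /v divfK ?subrr ?gt_eqF ?stat_gt0.
apply: (back _ (w (n.+1 - q)%N)); first exact/IH/ltnW.
by rewrite -[in X in _ < X](subnSK qn); apply: wp; rewrite subSS ltnS leq_subr.
Qed.

(* Fredholm alternative: a function orthogonal to the unique invariant
   vector p lies in the range of 1 - P. *)
Lemma poisson_equation (f : 'I_N -> R) :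
  \sum_i p i * f i = 0 ->
  exists g, forall i, f i = g i - \sum_j P i j * g j.
Proof.
move=> pf0.
pose v : 'rV[R]_N := \row_i f i.
pose A : 'M[R]_N := (1%:M - (P : 'M[R]_N))^T.
suff /submxP [D vD] : (v <= A)%MS.
  exists (fun i => D 0 i) => i.
  have /rowP /(_ i) := vD; rewrite !mxE => ->.
  under eq_bigr do rewrite !mxE mulrBr.
  rewrite sumrB; congr (_ - _).
    rewrite (bigD1 i) //= eqxx mulr1 big1 ?addr0 // => j ji.
    by rewrite eq_sym (negbTE ji) mulr0.
  by apply: eq_bigr => j _; rewrite mulrC.
(* Membership in the row space of [A] is tested against the columns of its cokernel. Each such
   column is an invariant vector, hence a multiple of [p], and [f] is orthogonal to [p]. *)
rewrite submxE; apply/eqP/rowP => l.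
move: (cokermx A) (mulmx_coker A) => B AB.
pose u i := B i l.
have uP j : \sum_i u i * P i j = u j.
  have /matrixP /(_ j l) := AB; rewrite !mxE.
  under eq_bigr do rewrite !mxE mulrBl.
  rewrite sumrB (bigD1 j) //= eqxx mul1r big1 ?addr0.
    by move/eqP; rewrite subr_eq0 /u => /eqP ->; apply: eq_bigr => i _; rewrite mulrC.
  by move=> i /negbTE ij; rewrite ij mul0r.
have [c uc] := invariant_unique uP.
rewrite !mxE; under eq_bigr => i _ do rewrite mxE -/(u i) uc.
transitivity (c * \sum_i p i * f i); last by rewrite pf0 mulr0.
by rewrite mulr_sumr; apply: eq_bigr => i _; ring.
Qed.

Definition entropy : R := - \sum_i \sum_j p i * P i j * ln (P i j).

Lemma tmat_le1 i j : P i j <= 1.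
Proof.
rewrite -(tmat_sum1 P i) (bigD1 j) //= lerDl sumr_ge0 // => k _.
exact: tmat_ge0.
Qed.

Lemma entropy_ge0 : 0 <= entropy.
Proof.
rewrite oppr_ge0 sumr_le0 // => i _; rewrite sumr_le0 // => j _.
rewrite mulr_ge0_le0 ?mulr_ge0 ?tmat_ge0 ?ln_le0 ?tmat_le1 //.
exact/ltW/stat_gt0.
Qed.

End chain.

(** * Exponential concentration of the information of a word *)

Section large_deviation.
Variables (R : realType) (N : nat) (P : irr_stochastic R N) (p : 'I_N -> R).
Hypothesis p_stat : stationary P p.
Implicit Types (i j : 'I_N) (s w : seq 'I_N) (m : nat).

(** Invert [1 - x <= expR (- x)]; on this range the quadratic dominates [(1 - x)^-1]. *)
Lemma expR_le_quad (x : R) : `|x| <= 2^-1 -> expR x <= 1 + x + 2 * x ^+ 2.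
Proof.
rewrite ler_norml => /andP[x1 x2].
have h : 1 - x <= expR (- x) by rewrite -[- x]/(- x) expR_ge1Dx.
have x0 : 0 < 1 - x by lra.
have q : 1 <= (1 + x + 2 * x ^+ 2) * (1 - x).
  have : 0 <= x ^+ 2 * (1 - 2 * x) by rewrite mulr_ge0 ?sqr_ge0 //; lra.
  by move=> ?; nra.
rewrite -[x in expR x]opprK expRN -div1r ler_pdivrMr ?expR_gt0 //.
apply: (le_trans q); rewrite ler_wpM2l //; nra.
Qed.

(** The linear term of the quadratic bound averages to zero, and the remainder is absorbed by
    [1 + a <= expR a]. *)
Lemma centered_exp_moment (q y : 'I_N -> R) (B t : R) :
  (forall i, 0 <= q i) -> \sum_i q i = 1 -> \sum_i q i * y i = 0 ->
  (forall i, `|y i| <= B) -> `|t| * B <= 2^-1 ->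
  \sum_i q i * expR (t * y i) <= expR (2 * (t * B) ^+ 2).
Proof.
move=> q0 q1 qy yB tB.
apply: (le_trans _ (expR_ge1Dx _)).
have -> : 1 + 2 * (t * B) ^+ 2 =
    \sum_i q i * (1 + t * y i + 2 * (t * B) ^+ 2).
  under eq_bigr do rewrite !mulrDr mulr1 (mulrCA _ t).
  by rewrite !big_split /= -mulr_sumr qy q1 mulr0 addr0 -mulr_suml q1 mul1r.
apply: ler_sum => i _; apply: ler_wpM2l => //.
have tyB : `|t * y i| <= `|t| * B by rewrite normrM ler_wpM2l.
apply: le_trans (expR_le_quad (le_trans tyB tB)) _.
rewrite lerD2l ler_wpM2l // -real_normK ?num_real //.
rewrite -[leRHS]real_normK ?num_real //.
by rewrite lerXn2r ?nnegrE // (le_trans tyB) // normrM ler_wpM2l // ler_norm.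
Qed.

Let h := entropy P p.

(** Chernoff's method for a martingale with bounded increments, applied to both signs of the
    deviation. *)
Lemma large_deviation (eps : R) : 0 < eps ->
  exists C c : R, [/\ 0 < C, 0 < c & forall m,
    \sum_(w <- words N m.+1 | eps * m%:R <= `|- ln (wprob P p w) - h * m%:R|)
      wprob P p w <= C * expR (- c * m%:R)].
Proof.
move=> eps0.
have [_ p1 pP] := p_stat.
(* The entropy of row [i], centered. Solving the Poisson equation for [phi] gives the coboundary [g]
   that turns the information into a martingale. *)
pose phi i := - (\sum_j P i j * ln (P i j)) - h.
have phi0 : \sum_i p i * phi i = 0.
  rewrite /phi; under eq_bigr do rewrite mulrBr mulrN.
  rewrite sumrB -mulr_suml p1 mul1r sumrN; apply/eqP; rewrite subr_eq0.
  apply/eqP; rewrite /h /entropy; congr (- _); apply: eq_bigr => i _.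
  by rewrite mulr_sumr; apply: eq_bigr => j _; rewrite mulrA.
have [g gE] := poisson_equation p_stat phi0.
(* Martingale increment of the transition from [j] to [i]; its conditional mean given [j] vanishes
   by the choice of [g]. *)
pose y j i := - ln (P j i) - h + g i - g j.
have y0 j : \sum_i P j i * y j i = 0.
  rewrite /y; under eq_bigr do rewrite mulrBr mulrDr mulrBr mulrN.
  rewrite sumrB big_split sumrB sumrN /= -!mulr_suml tmat_sum1 !mul1r.
  by have := gE j; rewrite /phi => ?; lra.
pose B := 1 + \sum_j \sum_i `|y j i|.
have yB j i : `|y j i| <= B.
  rewrite /B (bigD1 j) //= (bigD1 i) //=; set a := \sum_(k | _) _.
  have a0 : 0 <= a by rewrite sumr_ge0.
  set b := \sum_(k | _) _; have b0 : 0 <= b.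
    by rewrite sumr_ge0 // => ? _; rewrite sumr_ge0.
  lra.
have B1 : 1 <= B by rewrite lerDl sumr_ge0 // => ? _; rewrite sumr_ge0.
pose G := \sum_i `|g i|.
have gG i : `|g i| <= G by rewrite /G (bigD1 i) //= lerDl sumr_ge0.
pose wp := wprob P p.
(* Exponential moment of the corrected information after [m] transitions. One more transition
   multiplies it by at most [expR (2 * (t * B) ^+ 2)]. *)
pose Z t m := \sum_j \sum_(s <- words N m)
  wp (j :: s) * expR (t * (- ln (wp (j :: s)) - h * m%:R + g j)).
have ZE t m : Z t m = \sum_(w <- words N m.+1)
    wp w * expR (t * (- ln (wp w) - h * m%:R + oapp g 0 (ohead w))).
  by rewrite big_words.
have ZS t m : `|t| * B <= 2^-1 -> Z t m.+1 <= Z t m * expR (2 * (t * B) ^+ 2).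
  move=> tB; rewrite ZE sum_wprob_cons mulr_suml; apply: ler_sum => j _.
  rewrite mulr_suml; apply: ler_sum => s _.
  have := wprob_ge0 p_stat (j :: s).
  rewrite le_eqVlt => /predU1P[w0|w0].
    by rewrite /wp -w0 !mul0r.
  rewrite -mulrA ler_wpM2l ?wprob_ge0 //.
  apply: le_trans (_ : expR (t * (- ln (wp (j :: s)) - h * m%:R + g j)) *
    \sum_i P j i * expR (t * y j i) <= _); last first.
    rewrite ler_wpM2l ?expR_ge0 //; apply: centered_exp_moment => //.
    - exact: tmat_ge0.
    - exact: tmat_sum1.
  rewrite mulr_sumr; apply: ler_sum => i _ /=.
  have := tmat_ge0 P j i.
  rewrite le_eqVlt => /predU1P[P0|P0]; first by rewrite -P0 !mul0r mulr0.
  rewrite mulrCA ler_wpM2l ?tmat_ge0 // -expRD.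
  rewrite /wp -/(wprob P p (j :: s)) lnM ?posrE //.
  rewrite le_eqVlt; apply/orP; left; apply/eqP; congr expR.
  by rewrite /y -[m.+1%:R]natr1; ring.
have Zle t m : `|t| * B <= 2^-1 ->
    Z t m <= Z t 0%N * expR (2 * (t * B) ^+ 2 * m%:R).
  move=> tB; elim: m => [|m IH]; first by rewrite mulr0 expR0 mulr1.
  apply: le_trans (ZS _ _ tB) _.
  have -> : 2 * (t * B) ^+ 2 * m.+1%:R =
      2 * (t * B) ^+ 2 * m%:R + 2 * (t * B) ^+ 2.
    by rewrite -[m.+1%:R]natr1 mulrDr mulr1.
  rewrite expRD mulrA.
  by rewrite ler_wpM2r // expR_ge0.
have Z0 t m : 0 <= Z t m.
  by rewrite ZE sumr_ge0 // => w _; rewrite mulr_ge0 ?expR_ge0 ?wprob_ge0.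
(* The first bound admits the quadratic estimate of the exponential; the second makes the growth
   rate [2 * (t * B) ^+ 2] at most half of the gain [t * eps]. *)
pose t := Num.min (2 * B)^-1 (eps / (4 * B ^+ 2)).
have B0 : 0 < B by lra.
have t0 : 0 < t by rewrite lt_min invr_gt0 divr_gt0 ?mulr_gt0 ?exprn_gt0.
have tB : t * B <= 2^-1.
  by rewrite -ler_pdivlMr // -invfM ge_min lexx.
have tB2 : 4 * (t * B) ^+ 2 <= t * eps.
  have -> : 4 * (t * B) ^+ 2 = t * (t * (4 * B ^+ 2)) by ring.
  rewrite (ler_wpM2l (ltW t0)) //.
  by rewrite -ler_pdivlMr ?mulr_gt0 ?exprn_gt0 // ge_min lexx orbT.
pose c := t * eps - 2 * (t * B) ^+ 2.
exists (expR (t * G) * (Z t 0%N + Z (- t) 0%N) + 1), c; split.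
- by rewrite ltr_pwDr // mulr_ge0 ?expR_ge0 // addr_ge0.
- have : 0 < t * eps by rewrite mulr_gt0.
  by rewrite /c; lra.
move=> m.
(* Markov's inequality: on a deviating word one of the two exponentials, for [t] or [- t],
   compensates the prefactor, where [expR (t * G)] pays for the bounded coboundary. *)
apply: le_trans (_ : expR (t * G) * expR (- (t * eps) * m%:R) *
   (Z t m + Z (- t) m) <= _).
  rewrite !ZE -big_split mulr_sumr big_mkcond /= -/wp.
  apply: ler_sum => w _.
  have wp0 : 0 <= wp w by exact: wprob_ge0.
  case: ifP => [dev|_]; last first.
    by rewrite !mulr_ge0 ?addr_ge0 ?mulr_ge0 ?expR_ge0.
  rewrite -mulrDr mulrCA -[leLHS]mulr1 ler_wpM2l //.
  set a := - ln _ - _ in dev *; set b := oapp _ _ _.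
  have bG : `|b| <= G.
    by rewrite /b; case: (w) => [|? ?] //=; rewrite normr0 sumr_ge0.
  rewrite mulrDr -!expRD.
  have key (x : R) : 0 <= x -> 1 <= expR x by move=> ?; have := expR_ge1Dx x; lra.
  move: bG; rewrite ler_norml => /andP[b1 b2].
  move: dev; rewrite ler_normr => /orP[dev|dev].
    rewrite ler_wpDr ?expR_ge0 ?key //.
    have -> : t * G + - (t * eps) * m%:R + t * (a + b) =
       t * (G + b) + t * (a - eps * m%:R) by ring.
    by rewrite addr_ge0 // (mulr_ge0 (ltW t0)) ?subr_ge0 //; lra.
  rewrite ler_wpDl ?expR_ge0 ?key //.
  have -> : t * G + - (t * eps) * m%:R + - t * (a + b) =
     t * (G - b) + t * (- a - eps * m%:R) by ring.
  by rewrite addr_ge0 // (mulr_ge0 (ltW t0)) ?subr_ge0 //; lra.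
have tt : `|t| = t by rewrite gtr0_norm.
have h1 := Zle t m; rewrite tt in h1; move/(_ tB) in h1.
have h2 := Zle (- t) m; rewrite normrN tt in h2; move/(_ tB) in h2.
rewrite mulNr sqrrN in h2.
apply: le_trans (_ : expR (t * G) * expR (- (t * eps) * m%:R) *
   ((Z t 0%N + Z (- t) 0%N) * expR (2 * (t * B) ^+ 2 * m%:R)) <= _).
  by rewrite ler_wpM2l ?mulr_ge0 ?expR_ge0 // mulrDl lerD.
have -> : - c * m%:R = - (t * eps) * m%:R + 2 * (t * B) ^+ 2 * m%:R.
  by rewrite /c; ring.
rewrite expRD [leRHS]mulrDl mul1r mulrACA !mulrA.
by rewrite lerDl mulr_ge0 // expR_ge0.
Qed.

End large_deviation.

(** * Topology of the metric of an arbitrary norm, and distances to sets *)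

Lemma cvg_weighted_dist (R : realType) (T : topologicalType) (I : Type)
    (r : seq I) (x : T) (c : I -> T -> R) (b : I -> R) :
  (forall j, c j y @[y --> x] --> c j x) ->
  \sum_(j <- r) `|c j x - c j y| * b j @[y --> x] --> (0 : R).
Proof.
move=> cc; elim: r => [|j r IH].
  by under eq_fun do rewrite big_nil; exact: cvg_cst.
have h : `|c j x - c j y| * b j @[y --> x] --> (0 : R).
  rewrite -[X in _ --> X](mul0r (b j)); apply: cvgM; last exact: cvg_cst.
  rewrite -[X in _ --> X](@normr0 _ R) -(subrr (c j x)).
  by apply: cvg_norm; apply: cvgB => //; exact: cvg_cst.
under eq_fun do rewrite big_cons.
by have := cvgD h IH; rewrite addr0 => /(_ (nbhs_filter x)); apply.
Qed.

Section norm.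
Variables (R : realType) (k : nat) (nrm : 'rV[R]_k -> R).
Hypothesis nrm_norm : is_norm nrm.
Implicit Types x y z : 'rV[R]_k.

Lemma is_norm0 : nrm 0 = 0.
Proof. by case: nrm_norm => _ h _; rewrite -(scale0r 0) h normr0 mul0r. Qed.

Lemma is_normN x : nrm (- x) = nrm x.
Proof. by case: nrm_norm => _ h _; rewrite -scaleN1r h normrN1 mul1r. Qed.

Lemma is_norm_ge0 x : 0 <= nrm x.
Proof.
case: nrm_norm => tri _ _; have := tri x (- x).
by rewrite subrr is_norm0 is_normN; lra.
Qed.

Lemma nrm_dist_ge0 x y : 0 <= metric nrm x y. Proof. exact: is_norm_ge0. Qed.

Lemma nrm_distxx x : metric nrm x x = 0.
Proof. by rewrite /metric subrr is_norm0. Qed.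

Lemma nrm_distC x y : metric nrm x y = metric nrm y x.
Proof. by rewrite /metric -opprB is_normN. Qed.

Lemma nrm_dist_triangle y x z : metric nrm x z <= metric nrm x y + metric nrm y z.
Proof. by case: nrm_norm => tri _ _; rewrite /metric -(subrKA y) tri. Qed.

(** Expanding in the standard basis bounds the metric by a weighted sum of coordinate distances,
    which tends to 0 in the canonical topology. *)
Lemma metric_ball_nbhs x (e : R) (A : set 'rV[R]_k) :
  0 < e -> (forall y, metric nrm x y < e -> A y) -> nbhs x A.
Proof.
move=> e0 eA; have [tri hom _] := nrm_norm.
pose g y : R := \sum_(j < k) `|x 0 j - y 0 j| * nrm 'e_j.
have le_g y : metric nrm x y <= g y.
  rewrite /metric {1}(row_sum_delta x) {1}(row_sum_delta y) -sumrB /g.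
  apply: (big_ind2 (fun a b => nrm a <= b)) => [|a b c d ab cd|j _].
  - by rewrite is_norm0.
  - by rewrite (le_trans (tri _ _)) // lerD.
  - by rewrite -scalerBl hom.
have cg : g y @[y --> x] --> (0 : R).
  apply: (@cvg_weighted_dist _ _ _ _ x (fun j (y : 'rV[R]_k) => y 0 j)) => j.
  exact: coord_continuous.
have := cvgr_lt _ cg _ e0 => /(_ (nbhs_filter x)).
by apply: filterS => y /(le_lt_trans (le_g y)); exact: eA.
Qed.

Lemma open_metric_ball x (e : R) : open [set y | metric nrm x y < e].
Proof.
rewrite openE => y /= xy; have xy0 : 0 < e - metric nrm x y by lra.
apply: (metric_ball_nbhs xy0) => z /= yz.
by have := nrm_dist_triangle y x z; lra.
Qed.

Lemma metric_continuous x : continuous (metric nrm x).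
Proof.
move=> y; apply/(cvgrPdist_lt (FF := nbhs_filter y)) => e e0.
apply: (metric_ball_nbhs e0) => z yz.
have := nrm_dist_triangle z x y; have := nrm_dist_triangle y x z.
by rewrite (nrm_distC z y) ltr_norml; lra.
Qed.

Lemma compact_metric_bounded (X : set 'rV[R]_k) : compact X ->
  exists2 D : R, 1 <= D & forall x y, X x -> X y -> metric nrm x y <= D.
Proof.
move=> cX.
have : compact (metric nrm 0 @` X).
  apply: continuous_compact => //; apply: continuous_subspaceT.
  exact: metric_continuous.
move=> /compact_bounded [M [Mreal MX]].
pose K := Num.max 1 (M + 1).
have XK x : X x -> metric nrm 0 x <= K.
  move=> Xx; apply: le_trans (ler_norm _) _; apply: (MX K).
    by rewrite lt_max ltrDl ltr01 orbT.
  by exists x.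
have K1 : 1 <= K by rewrite le_max lexx.
exists (K + K) => [|x y /XK xK /XK yK]; first lra.
by have := nrm_dist_triangle 0 x y; rewrite (nrm_distC x 0); lra.
Qed.

Lemma dist_pt_set_le x (A : set 'rV[R]_k) a : A a ->
  dist_pt_set nrm x A <= metric nrm x a.
Proof.
move=> Aa; apply: ge_inf; last by exists a.
by exists 0 => _ [b _ <-]; exact: nrm_dist_ge0.
Qed.

Lemma dist_pt_set_ge x (A : set 'rV[R]_k) (r : R) : A !=set0 ->
  (forall a, A a -> r <= metric nrm x a) -> r <= dist_pt_set nrm x A.
Proof.
move=> [a Aa] h; apply: lb_le_inf; first by exists (metric nrm x a), a.
by move=> _ [b Ab <-]; exact: h.
Qed.

Lemma open_dist_pt_set_gt (A : set 'rV[R]_k) (r : R) : A !=set0 ->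
  open [set x | r < dist_pt_set nrm x A].
Proof.
move=> A0; rewrite openE => x /= rx.
have e0 : 0 < (dist_pt_set nrm x A - r) / 2 by lra.
apply: (metric_ball_nbhs e0) => y /= xy.
suff : dist_pt_set nrm x A - (dist_pt_set nrm x A - r) / 2
    <= dist_pt_set nrm y A by lra.
apply: dist_pt_set_ge => // a Aa.
have := dist_pt_set_le x Aa; have := nrm_dist_triangle y x a.
by lra.
Qed.

Lemma dist_sets_le (A B : set 'rV[R]_k) a b : A a -> B b ->
  dist_sets nrm A B <= metric nrm a b.
Proof.
move=> Aa Bb; apply: ge_inf; last by exists a => //; exists b.
by exists 0 => _ [x _ [y _ <-]]; exact: nrm_dist_ge0.
Qed.

End norm.

(** * Geometry of cells: diameter, separation, refinement *)

Section cells.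
Variables (R : realType) (k N : nat) (nrm : 'rV[R]_k -> R).
Variables (P : irr_stochastic R N) (X : set 'rV[R]_k).
Variables (S : 'I_N -> 'rV[R]_k -> 'rV[R]_k) (slo shi : 'I_N -> R).
Variables (p : 'I_N -> R) (E : 'I_N -> set 'rV[R]_k).
Hypotheses (nrm_norm : is_norm nrm).
Hypotheses (hIFS : hyperbolic_recurrent_IFS nrm X S slo shi).
Hypotheses (p_stat : stationary P p) (E_lim : limit_sets P X S E).
Hypotheses (E_sep : strong_separation nrm P S E).
Implicit Types (i j : 'I_N) (s t u v w : seq 'I_N) (x y : 'rV[R]_k).
Local Notation d := (metric nrm).
Local Notation wprob := (wprob P p).

Fixpoint cell w : set 'rV[R]_k :=
  if w is i :: w' then
    if w' is _ :: _ then S i @` cell w' else E i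
  else set0.

Lemma limit_setE i x : E i x <-> exists j y, [/\ 0 < P j i, E j y & S i y = x].
Proof.
have [_ h] := E_lim; split.
  by rewrite h => -[j Pji [y Ey <-]]; exists j, y.
by move=> [j [y [Pji Ey <-]]]; rewrite h; exists j => //; exists y.
Qed.

Lemma limit_set_sub i : E i `<=` X.
Proof. by case: E_lim => /(_ i)[]. Qed.

Lemma cell_sub i s : 0 < wprob (i :: s) -> cell (i :: s) `<=` E i.
Proof.
elim: s i => [|j s IH] i; first by move=> _ x.
rewrite wprob_cons_gt0 // => /andP[Pji /IH jE].
by move=> _ [x /jE xE <-]; apply/limit_setE; exists j, x.
Qed.

Lemma cell_subX w : 0 < wprob w -> cell w `<=` X.
Proof.
case: w => [|i s]; first by rewrite ltxx.
by move=> /cell_sub iE x /iE /limit_set_sub.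
Qed.

Lemma slo_gt0 i : 0 < slo i. Proof. by case: hIFS => _ _ /(_ i)[]. Qed.
Lemma slo_le i : slo i <= shi i. Proof. by case: hIFS => _ _ /(_ i)[]. Qed.
Lemma shi_lt1 i : shi i < 1. Proof. by case: hIFS => _ _ /(_ i)[]. Qed.

Lemma shi_gt0 i : 0 < shi i.
Proof. exact: lt_le_trans (slo_gt0 i) (slo_le i). Qed.

Definition clo i := - ln (slo i).
Definition chi i := - ln (shi i).

Lemma chi_gt0 i : 0 < chi i.
Proof. by rewrite oppr_gt0 ln_lt0 // shi_gt0 shi_lt1. Qed.

Lemma clo_gt0 i : 0 < clo i.
Proof.
by rewrite oppr_gt0 ln_lt0 // slo_gt0 (le_lt_trans (slo_le i)) ?shi_lt1.
Qed.

Lemma contr_lo i x y : X x -> X y -> slo i * d x y <= d (S i x) (S i y).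
Proof. by case: hIFS => _ _ _ h Xx Xy; have /andP[] := h i x y Xx Xy. Qed.

Lemma contr_hi i x y : X x -> X y -> d (S i x) (S i y) <= shi i * d x y.
Proof. by case: hIFS => _ _ _ h Xx Xy; have /andP[] := h i x y Xx Xy. Qed.

Lemma wsum_ge0 (c : 'I_N -> R) w : (forall i, 0 <= c i) -> 0 <= wsum c w.
Proof.
move=> c0; elim: w => [|i [|j s] IH] //; by rewrite /= addr_ge0.
Qed.

Lemma wsum_rcons (c : 'I_N -> R) i s j :
  wsum c (rcons (i :: s) j) = wsum c (i :: s) + c (last i s).
Proof.
elim: s i => [|l s IH] i; first by rewrite /= addr0 add0r.
by have /= -> := IH l; rewrite addrA.
Qed.

Lemma cell_diam (D : R) w x y : (forall x y, X x -> X y -> d x y <= D) ->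
  0 < wprob w -> cell w x -> cell w y -> d x y <= D * expR (- wsum chi w).
Proof.
move=> XD; elim: w x y => [|i [|j s] IH] x y //.
  by move=> wp ix iy; rewrite oppr0 expR0 mulr1 XD //; exact: cell_subX wp _ _.
move=> /[dup] wp; rewrite wprob_cons_gt0 // => /andP[_ wp'].
move=> [x' x'w <-] [y' y'w <-].
have [x'X y'X] : X x' /\ X y' by split; exact: cell_subX wp' _ _.
apply: le_trans (contr_hi i x'X y'X) _.
rewrite [wsum _ _]/= -/(wsum chi (j :: s)) opprD opprK expRD lnK ?posrE ?shi_gt0 //.
by rewrite mulrCA ler_wpM2l ?IH // ltW // shi_gt0.
Qed.

(** Points of distinct limit sets lie in images [S i @] E a[and]S j @[E b] with different pairs of
    indices, so the minimum of the finitely many positive distances of strong separation serves; the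
    default 1 caps it. *)
Lemma limit_sets_separated : exists2 delta : R, 0 < delta <= 1 &
  forall i j x y, i != j -> E i x -> E j y -> delta <= d x y.
Proof.
pose q := ('I_N * 'I_N * 'I_N * 'I_N)%type.
pose ok (z : q) := ((z.1.1.2, z.1.1.1) != (z.2, z.1.2)) &&
  (0 < P z.1.1.2 z.1.1.1 * P z.2 z.1.2).
pose ds (z : q) :=
  dist_sets nrm (S z.1.1.1 @` E z.1.1.2) (S z.1.2 @` E z.2).
exists (\big[Num.min/1]_(z | ok z) ds z).
  rewrite bigmin_le_id andbT; apply: lt_bigmin => // z /andP[z1 z2].
  exact: E_sep.
move=> i j x y ij /limit_setE[a [x' [Pai Ex' <-]]] /limit_setE[b [y' [Pbj Ey' <-]]].
apply: le_trans (_ : ds (i, a, j, b) <= _).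
  apply: bigmin_le_cond; rewrite /ok /= mulr_gt0 // andbT.
  by apply: contra ij => /eqP[_ ->].
by apply: dist_sets_le => //; [exists x'|exists y'].
Qed.

(** Distinct words of equal length differ at some position. Each letter of the common prefix costs a
    factor [slo], and the first differing letters put the points in different limit sets; the
    remaining letters only weaken the bound. *)
Lemma cell_separated (delta : R) u v x y : 0 <= delta ->
  (forall i j x y, i != j -> E i x -> E j y -> delta <= d x y) ->
  u != v -> size u = size v -> 0 < wprob u -> 0 < wprob v ->
  cell u x -> cell v y -> delta * expR (- wsum clo u) <= d x y.
Proof.
move=> d0 sep; elim: u v x y => [|i s IH] [|j t] x y //; rewrite ?ltxx //.
move=> uv st pu pv ux vy; have [ij|ij] := eqVneq i j; last first.
  apply: le_trans (sep _ _ _ _ ij (cell_sub pu ux) (cell_sub pv vy)).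
  rewrite -[leRHS]mulr1 ler_wpM2l // expR_le1 oppr_le0 wsum_ge0 // => l.
  exact/ltW/clo_gt0.
subst j; move: uv; rewrite eqseq_cons eqxx /= => stn.
case: s t stn st IH pu pv ux vy => [|a s] [|b t] //= stn [st] IH.
rewrite -/(wprob (a :: s)) -/(wprob (b :: t)) => pu pv.
have [_ wa] : 0 < P a i /\ 0 < wprob (a :: s).
  by apply/andP; rewrite -(wprob_cons_gt0 p_stat).
have [_ wb] : 0 < P b i /\ 0 < wprob (b :: t).
  by apply/andP; rewrite -(wprob_cons_gt0 p_stat).
move=> [x' ux <-] [y' vy <-].
have xX : X x' by exact: cell_subX wa _ ux.
have yX : X y' by exact: cell_subX wb _ vy.
apply: le_trans (contr_lo i xX yX).
rewrite opprD opprK expRD lnK ?posrE ?slo_gt0 // mulrCA.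
rewrite ler_wpM2l ?(ltW (slo_gt0 i)) //.
by apply: IH wa wb ux vy => //=; rewrite st.
Qed.

(** Appending a letter adds an earlier state, so the initial weight [p (last i s)] is traded for
    [p j * P j (last i s)]; the product form avoids a division. *)
Lemma wprob_rcons i s j : wprob (rcons (i :: s) j) * p (last i s) =
  wprob (i :: s) * (P j (last i s) * p j).
Proof.
elim: s i => [|l s IH] i /=; first by ring.
by rewrite -mulrA [X in _ * X]IH /= mulrA.
Qed.

Lemma wprob_rcons_gt0 i s j : 0 < wprob (i :: s) -> 0 < P j (last i s) ->
  0 < wprob (rcons (i :: s) j).
Proof.
move=> wp Pj; rewrite -(pmulr_lgt0 _ (stat_gt0 p_stat (last i s))).
by rewrite wprob_rcons !mulr_gt0 // (stat_gt0 p_stat).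
Qed.

Lemma cell_ext i s x : cell (i :: s) x ->
  exists2 j, 0 < P j (last i s) & cell (rcons (i :: s) j) x.
Proof.
elim: s i x => [|l s IH] i x.
  by move=> /limit_setE[j [y [Pj Ey <-]]]; exists j => //=; exists y.
by move=> [y /IH[j Pj jy] <-]; exists j => //; exists y.
Qed.

Lemma cell_cover i x m : E i x ->
  exists w, [/\ w \in words N m.+1, 0 < wprob w & cell w x].
Proof.
move=> Ex; elim: m => [|m [[|j s]]].
- by exists [:: i]; rewrite mem_words /= (stat_gt0 p_stat).
- by rewrite ltxx => -[].
rewrite mem_words => -[sz wp jx]; have [l Pl lx] := cell_ext jx.
exists (rcons (j :: s) l); rewrite mem_words size_rcons (eqP sz).
by split=> //; exact: wprob_rcons_gt0.
Qed.

End cells.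

(** * Integral comparison and measurability of the logarithmic distance *)

Lemma ae_le_integral d (T : measurableType d) (R : realType)
    (mu : {measure set T -> \bar R}) (A : set T) (f g : T -> \bar R) :
  measurable A -> mu (~` A) = 0%E ->
  measurable_fun setT f -> measurable_fun setT g ->
  (forall x, A x -> (f x <= g x)%E) ->
  (\int[mu]_x f x <= \int[mu]_x g x)%E.
Proof.
move=> mA A0 mf mg fg; rewrite (integralE _ _ f) (integralE _ _ g).
have ae (Q : T -> Prop) : (forall x, A x -> Q x) -> {ae mu, forall x, Q x}.
  move=> AQ; exists (~` A); split => //; first exact: measurableC.
  by move=> x /= nQ /AQ.
apply: leeB; apply: ae_ge0_le_integral => //.
- exact: measurable_funepos.
- exact: measurable_funepos.
- apply: ae => x Ax _; rewrite !funeposE ge_max le_max fg //=.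
  by rewrite le_max lexx orbT.
- exact: measurable_funeneg.
- exact: measurable_funeneg.
- apply: ae => x Ax _; rewrite !funenegE ge_max le_max leeN2 fg //=.
  by rewrite le_max lexx orbT.
Qed.

Lemma open_borel (T : ptopologicalType) (A : set (borel T)) :
  open (A : set T) -> measurable A.
Proof. by move=> oA; apply: sub_sigma_algebra. Qed.

Lemma closed_borel (T : ptopologicalType) (A : set (borel T)) :
  closed (A : set T) -> measurable A.
Proof.
move=> cA; rewrite -(setCK A); apply: measurableC; apply: open_borel.
exact: closed_openC.
Qed.

Lemma lt_lne (R : realType) (r t : R) : (r%:E < lne t%:E)%E = (expR r < t).
Proof.
have [t0|t0] := leP t 0.
  rewrite le0_lneNy ?lee_fin // ltNge leNye ltNge.
  by rewrite (le_trans t0) // expR_ge0.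
by rewrite lne_EFin // lte_fin -[LHS]ltr_expR lnK ?posrE.
Qed.

Lemma measurable_lne_dist (R : realType) (k : nat) (nrm : 'rV[R]_k -> R)
    (A : set 'rV[R]_k) : is_norm nrm -> A !=set0 ->
  measurable_fun (setT : set (borel 'rV[R]_k))
    (fun x => lne (dist_pt_set nrm x A)%:E).
Proof.
move=> nn A0; apply: (measurability _ (ErealGenOInfty.measurableE R)).
move=> _ [_ [r ->] <-]; rewrite setTI.
rewrite (_ : _ @^-1` _ = [set x | expR r < dist_pt_set nrm x A]).
  by apply: open_borel; exact: open_dist_pt_set_gt.
apply/seteqP; split => x; rewrite /mkset /preimage -lt_lne => h.
  by move: h; rewrite /= in_itv => /andP[].
by rewrite /= in_itv /=; apply/andP.
Qed.

Lemma mkseqS (T : Type) (f : nat -> T) n :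
  mkseq f n.+1 = f 0%N :: mkseq (f \o succn) n.
Proof. by rewrite /mkseq /= (iotaDl 1 0) -map_comp. Qed.

(** * Mass of the cells and step functions on them *)

Section generated.
Variables (R : realType) (k N : nat) (nrm : 'rV[R]_k -> R).
Variables (P : irr_stochastic R N) (X : set 'rV[R]_k).
Variables (S : 'I_N -> 'rV[R]_k -> 'rV[R]_k) (slo shi : 'I_N -> R).
Variables (p : 'I_N -> R) (E : 'I_N -> set 'rV[R]_k).
Variable mu : probability (borel 'rV[R]_k) R.
Hypotheses (nrm_norm : is_norm nrm).
Hypotheses (hIFS : hyperbolic_recurrent_IFS nrm X S slo shi).
Hypotheses (p_stat : stationary P p) (E_lim : limit_sets P X S E).
Hypotheses (E_sep : strong_separation nrm P S E).
Hypotheses (mu_gen : generated_measure P S p E mu).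
Implicit Types (i j : 'I_N) (s t u v w : seq 'I_N) (x y : 'rV[R]_k).
Local Notation d := (metric nrm).
Local Notation wprob := (wprob P p).
Local Notation cell := (cell S E).
Local Notation clo := (clo slo).

Lemma measurable_limit_set i : measurable (E i : set (borel 'rV[R]_k)).
Proof.
apply: closed_borel; apply: compact_closed; first exact: norm_hausdorff.
by case: E_lim => /(_ i)[].
Qed.

Lemma cell_inj u v x : size u = size v -> 0 < wprob u -> 0 < wprob v ->
  cell u x -> cell v x -> u = v.
Proof.
move=> uv pu pv ux vx; apply: contrapT => /eqP nuv.
have [delta /andP[d0 _] sep] := limit_sets_separated nrm_norm E_lim E_sep.
have := cell_separated hIFS p_stat E_lim (ltW d0) sep nuv uv pu pv ux vx.
by rewrite nrm_distxx // leNgt mulr_gt0 ?expR_gt0.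
Qed.

(* Within the compact limit set, a cell is cut out by an open neighbourhood. *)
Lemma measurable_cell w : 0 < wprob w ->
  measurable (cell w : set (borel 'rV[R]_k)).
Proof.
case: w => [|i s] pw; first by rewrite ltxx in pw.
have [delta /andP[d0 _] sep] := limit_sets_separated nrm_norm E_lim E_sep.
pose r := delta * expR (- wsum clo (i :: s)).
have r0 : 0 < r by rewrite mulr_gt0 ?expR_gt0.
have -> : cell (i :: s) =
    E i `&` \bigcup_(x in cell (i :: s)) [set y | d x y < r].
  apply/seteqP; split => y.
    move=> yc; split; first exact: (cell_sub p_stat E_lim pw yc).
    by exists y => //=; rewrite nrm_distxx.
  move=> [Ey [x xc /= xy]].
  have [u [uN pu yu]] := cell_cover p_stat E_lim (size s) Ey.
  have us : size (i :: s) = size u by move: uN; rewrite mem_words => /eqP.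
  have [su|nu] := eqVneq (i :: s) u; first by move: yu; rewrite -su.
  have := cell_separated hIFS p_stat E_lim (ltW d0) sep nu us pw pu xc yu.
  by rewrite -/r leNgt xy.
apply: measurableI; first exact: measurable_limit_set.
apply: open_borel; apply: bigcup_open => x _; exact: open_metric_ball.
Qed.

Lemma cell_mkseq (f : nat -> 'I_N) n :
  S_word S f n @` E (f n) = cell (mkseq f n.+1).
Proof.
elim: n f => [|n IH] f.
  by rewrite /S_word big_ord0 /= image_id.
have -> : S_word S f n.+1 = S (f 0%N) \o S_word S (f \o succn) n.
  by rewrite /S_word big_ord_recl.
by rewrite -image_comp (IH (f \o succn)) [in RHS]mkseqS.
Qed.

Lemma wprob_mkseq (f : nat -> 'I_N) n :
  wprob (mkseq f n.+1) = p (f n) * \prod_(i < n) P (f i.+1) (f i).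
Proof.
elim: n f => [|n IH] f; first by rewrite big_ord0 mulr1.
rewrite big_ord_recl mulrCA -(IH (f \o succn)).
by rewrite [in LHS]mkseqS.
Qed.

(** The preimage of a cell under the coding map is the cylinder of its word: a coded point lies in
    the cells of its own code, and cells of equal length are disjoint. *)
Lemma mu_cell w : 0 < wprob w -> mu (cell w) = (wprob w)%:E.
Proof.
move=> pw; have [nu [pi [nuP piP muP]]] := mu_gen.
case: w pw => [|i s] pw; first by rewrite ltxx in pw.
pose f := nth i (i :: s); have fE : mkseq f (size s).+1 = i :: s.
  exact: mkseq_nth.
have := pw; rewrite -fE wprob_mkseq => pf.
have adm l : (l < size s)%N -> 0 < P (f l.+1) (f l).
  move=> ls; rewrite lt_neqAle tmat_ge0 andbT eq_sym; apply: contraTneq pf.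
  by move=> h; rewrite (bigD1 (Ordinal ls)) //= h mul0r mulr0 ltxx.
rewrite muP; last by rewrite fE; exact: measurable_cell.
rewrite -nuP //; congr (nu _).
have word (om : Omega P) n : 0 < wprob (mkseq (sval om) n.+1).
  rewrite wprob_mkseq mulr_gt0 ?(stat_gt0 p_stat) //.
  by rewrite prodr_gt0 // => l _; have /asboolP := svalP om; exact.
have in_cell (om : Omega P) n : cell (mkseq (sval om) n.+1) (pi om).
  have pin m : (0 < m)%N -> cell (mkseq (sval om) m.+1) (pi om).
    move=> m0; rewrite -cell_mkseq.
    by have : [set pi om] (pi om) by []; rewrite -piP; exact.
  (* The intersection defining the coding map starts at generation 1; generation 0 follows since
     cells decrease. *)
  case: n => [|n]; last exact: pin.
  by apply: (cell_sub p_stat E_lim (word om 1%N)); exact: (pin 1%N).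
apply/seteqP; split => om; rewrite /preimage /cylinder /mkset.
  rewrite fE => ci l ls.
  have := cell_inj _ (word om (size s)) pw (in_cell om (size s)) ci.
  rewrite size_mkseq => /(_ erefl) => /(congr1 (fun v => nth i v l)).
  by rewrite nth_mkseq // ltnS.
move=> omf; rewrite (_ : mkseq f _ = mkseq (sval om) (size s).+1) //.
by apply/eq_in_map => l; rewrite mem_iota => /andP[_ ls]; rewrite omf.
Qed.

Definition limit_set : set (borel 'rV[R]_k) := \bigcup_i E i.

Lemma measurable_limit_setU : measurable limit_set.
Proof.
by apply: fin_bigcup_measurable => // i _; exact: measurable_limit_set.
Qed.

Lemma mu_limit_setC : mu (~` limit_set) = 0%E.
Proof.
have [nu [pi [nuP piP muP]]] := mu_gen.
rewrite muP; last by apply: measurableC; exact: measurable_limit_setU.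
rewrite (_ : _ @^-1` _ = set0) ?measure0 //.
rewrite -subset0 => om /=; apply; exists (sval om 0%N) => //.
have /asboolP adm := svalP om.
have p1 : 0 < wprob (mkseq (sval om) 2).
  rewrite wprob_mkseq mulr_gt0 ?(stat_gt0 p_stat) //.
  by rewrite prodr_gt0 // => l _; exact: adm.
suff c1 : cell (mkseq (sval om) 2) (pi om).
  exact: (cell_sub p_stat E_lim p1 c1).
rewrite -cell_mkseq.
by have : [set pi om] (pi om) by []; rewrite -piP => /(_ 1%N); exact.
Qed.

(** Through these functions, expectations over words of the chain become integrals against [mu].
    Words of probability 0 are left out, as only the other cells are known to be disjoint. *)
Definition step m (c : seq 'I_N -> R) x : R :=
  \sum_(w <- words N m.+1 | 0 < wprob w) c w * \1_(cell w) x.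

Lemma step_ge0 m c x : (forall w, 0 <= c w) -> 0 <= step m c x.
Proof.
by move=> c0; rewrite sumr_ge0 // => w _; rewrite mulr_ge0 // indicE.
Qed.

Lemma step_cell m c x w : w \in words N m.+1 -> 0 < wprob w -> cell w x ->
  step m c x = c w.
Proof.
move=> wN pw wx; rewrite /step big_mkcond (bigD1_seq w) ?uniq_words //= pw.
rewrite indicE mem_set // mulr1 big1_seq ?addr0 // => v /andP[vw vN].
case: ifP => // pv.
rewrite indicE memNset ?mulr0 // => vx; move/eqP: vw; apply.
have vs : size v = m.+1 by apply/eqP; rewrite -mem_words.
have ws : size w = m.+1 by apply/eqP; rewrite -mem_words.
by apply: (cell_inj _ pv pw vx wx); rewrite vs ws.
Qed.

Lemma measurable_step m c :
  measurable_fun (setT : set (borel 'rV[R]_k)) (fun x => (step m c x)%:E).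
Proof.
apply/measurable_EFinP; rewrite /step.
under eq_fun do rewrite big_mkcond.
apply: measurable_sum => w; have [pw|_] := ltP 0 (wprob w); last first.
  exact: measurable_cst.
apply: measurable_funM => //.
by apply: measurable_indic; exact: measurable_cell.
Qed.

Lemma integral_step m c : (forall w, 0 <= c w) ->
  (\int[mu]_x (step m c x)%:E)%E =
  (\sum_(w <- words N m.+1) wprob w * c w)%:E.
Proof.
move=> c0; rewrite /step.
under eq_integral do rewrite big_mkcond -sumEFin.
rewrite ge0_integral_sum //=.
- rewrite -sumEFin; apply: eq_bigr => w _; have [pw|pw] := ltP 0 (wprob w).
    under eq_integral do rewrite EFinM.
    rewrite ge0_integralZl_EFin //.
    + rewrite integral_indic // ?setIT; last exact: measurable_cell.
      by rewrite [X in (_ * X)%E](mu_cell pw) -EFinM mulrC.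
    + by apply/measurable_EFinP; apply: measurable_indic; exact: measurable_cell.
  rewrite integral0.
  have -> : wprob w = 0 by apply/eqP; rewrite eq_le pw wprob_ge0.
  by rewrite mul0r.
- move=> w; apply/measurable_EFinP; have [pw|//] := ltP 0 (wprob w).
  apply: measurable_funM => //; by apply: measurable_indic; exact: measurable_cell.
- move=> w x *; rewrite lee_fin; case: ifP => // _;
  by rewrite mulr_ge0 // indicE.
Qed.

End generated.

(** * Upper and lower bounds for the quantization error *)

Section quantization_bounds.
Variables (R : realType) (k N : nat) (nrm : 'rV[R]_k -> R).
Variables (P : irr_stochastic R N) (X : set 'rV[R]_k).
Variables (S : 'I_N -> 'rV[R]_k -> 'rV[R]_k) (slo shi : 'I_N -> R).
Variables (p : 'I_N -> R) (E : 'I_N -> set 'rV[R]_k).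
Variable mu : probability (borel 'rV[R]_k) R.
Hypotheses (nrm_norm : is_norm nrm).
Hypotheses (hIFS : hyperbolic_recurrent_IFS nrm X S slo shi).
Hypotheses (p_stat : stationary P p) (E_lim : limit_sets P X S E).
Hypotheses (E_sep : strong_separation nrm P S E).
Hypotheses (mu_gen : generated_measure P S p E mu).
Implicit Types (i j : 'I_N) (s t u v w : seq 'I_N) (x y : 'rV[R]_k).
Local Notation d := (metric nrm).
Local Notation wprob := (wprob P p).
Local Notation cell := (cell S E).
Local Notation clo := (clo slo).
Local Notation chi := (chi shi).
Local Notation step := (step P S p E).
Let h := entropy P p.

Lemma cell_nonempty w : 0 < wprob w -> cell w !=set0.
Proof.
elim: w => [|i [|j s] IH] //; first by rewrite ltxx.
  by case: E_lim => /(_ i)[].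
rewrite wprob_cons_gt0 // => /andP[_ /IH[x jx]].
by exists (S i x); exists x.
Qed.

Lemma wsum_le (c : 'I_N -> R) (C : R) w m : (forall i, c i <= C) ->
  size w = m.+1 -> wsum c w <= C * m%:R.
Proof.
move=> cC; elim: m w => [|m IH] [|i [|j s]] //=; first by rewrite mulr0.
move=> [sz].
rewrite -[m.+1%:R]natr1 mulrDr mulr1 addrC.
by apply: lerD => //; apply: (IH (j :: s)); rewrite /= sz.
Qed.

(* The quantizer takes one point in each cell of generation m whose mass is at
   least exp(-Hm); since H exceeds the entropy these cells carry almost all of
   the mass, and there are at most exp(Hm) of them. *)
Lemma quant_error_upper (H : R) : h < H ->
  exists B : R, forall m n, (0 < n)%N -> H * m%:R <= ln (n%:R) ->
    (quant_error0 nrm mu n <= (B - m%:R * \sum_i p i * chi i)%:E)%E.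
Proof.
move=> hH; have e0 : 0 < H - h by lra.
have [C [c [C0 c0 LD]]] := large_deviation p_stat e0.
have [D D1 XD] : exists2 D : R, 1 <= D & forall x y, X x -> X y -> d x y <= D.
  by apply: compact_metric_bounded => //; case: hIFS => -[].
have D0 : 0 < D by lra.
pose C1 := \sum_i chi i.
have chi0 i : 0 <= chi i by exact/ltW/(chi_gt0 hIFS).
have chiC i : chi i <= C1 by rewrite /C1 (bigD1 i) //= lerDl sumr_ge0.
have C10 : 0 <= C1 by rewrite sumr_ge0.
(* [ln D] comes from the diameter bound for cells; [C1 * C / c] bounds the loss [C1 * m%:R] on
   atypical cells times their mass, uniformly in [m]. *)
exists (ln D + C1 * C / c) => m n n0 Hmn.
pose dev w := (H - h) * m%:R <= `|- ln (wprob w) - h * m%:R|.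
pose good w := (0 < wprob w) && ~~ dev w.
pose L0 := [seq w <- words N m.+1 | good w].
(* Each good word has mass at least [expR (- (H * m%:R))] and the total mass is 1. *)
have L0n : (size L0 <= n)%N.
  have : \sum_(w <- L0) expR (- (H * m%:R)) <= 1.
    rewrite -[leRHS](sum_wprob p_stat m) big_filter [leRHS]big_mkcond [leLHS]big_mkcond.
    apply: ler_sum => w _; case: ifP => [/andP[pw]|_]; last exact: wprob_ge0.
    rewrite /dev -ltNge ltr_norml => /andP[_ hw].
    by rewrite -[leRHS]lnK ?posrE // ler_expR; lra.
  rewrite big_const_seq count_predT iter_addr_0 -[leLHS]mulr_natr expRN.
  rewrite [leLHS]mulrC ler_pdivrMr ?expR_gt0 // mul1r => h1.
  rewrite -(ler_nat R) (le_trans h1) //.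
  by rewrite -[leRHS]lnK ?posrE ?ltr0n // ler_expR.
have N0 : (0 < N)%N by rewrite (leq_trans _ (order_ge2 P)).
have [w0 w0N pw0] : exists2 w0, w0 \in words N m.+1 & 0 < wprob w0.
  have [x0 Ex0] : E (Ordinal N0) !=set0 by case: E_lim => /(_ (Ordinal N0))[].
  by have [w0 [? ? _]] := cell_cover p_stat E_lim m Ex0; exists w0.
(* If no word is good, an arbitrary word of positive probability keeps the quantizer nonempty. *)
have [L [Ln L0L Lne Lp]] : exists L, [/\ (size L <= n)%N,
    (forall w, w \in L0 -> w \in L), exists w, w \in L &
    forall w, w \in L -> 0 < wprob w].
  have [L0e|L0e] := eqVneq L0 [::].
    exists [:: w0]; split => //.
    - by rewrite L0e => w; rewrite in_nil.
    - by exists w0; rewrite mem_head.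
    - by move=> w; rewrite inE => /eqP ->.
  exists L0; split => //.
    by case: (L0) L0e => // w l _; exists w; rewrite mem_head.
  by move=> w; rewrite mem_filter => /andP[/andP[]].
have /choice[xw xwP] : forall w, exists x, 0 < wprob w -> cell w x.
  move=> w; have [pw|pw] := ltP 0 (wprob w); last by exists 0.
  by have [x wx] := cell_nonempty pw; exists x.
pose A := [set xw w | w in [set` L]].
have A0 : A !=set0 by have [w wL] := Lne; exists (xw w), w.
have AX a : A a -> X a.
  by move=> [w /Lp pw <-]; apply: (cell_subX p_stat E_lim pw); exact: xwP.
have An : (A #<= `I_n)%card.
  apply: card_le_trans (card_image_le _ _) _.
  apply/pcard_leP; case: (Lne) => w1 w1L.
  have := @card_image_le nat _ (nth w1 L) `I_(size L).
  rewrite (_ : _ @` _ = [set` L]); last first.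
    apply/seteqP; split => [_ [l lL <-]|w /= wL]; first exact: mem_nth.
    by exists (index w L); rewrite ?nth_index //= index_mem.
  move=> h1; apply/pcard_leP; apply: card_le_trans h1 _.
  by rewrite card_le_II.
apply: (le_trans (ereal_inf_lbound _)); first by exists A.
(* Outside the good cells only the crude bound [D] on the distance is available. *)
pose cw w := if good w then wsum chi w else 0.
have cw0 w : 0 <= cw w by rewrite /cw; case: ifP => // _; exact: wsum_ge0.
have mstep := measurable_step nrm_norm hIFS p_stat E_lim E_sep.
have le_int : (\int[mu]_x lne (dist_pt_set nrm x A)%:E <=
    \int[mu]_x ((ln D)%:E - (step m cw x)%:E))%E.
  apply: (ae_le_integral (A := limit_set E)).
  - exact: measurable_limit_setU E_lim.
  - exact: (mu_limit_setC p_stat E_lim mu_gen).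
  - exact: measurable_lne_dist.
  - by apply: emeasurable_funB => //; exact: mstep.
  move=> x [i _ Ex]; have Xx := limit_set_sub E_lim Ex.
  have [w [wN pw wx]] := cell_cover p_stat E_lim m Ex.
  rewrite (step_cell nrm_norm hIFS p_stat E_lim E_sep _ wN pw wx) -EFinB.
  rewrite leNgt lt_lne -leNgt expRB lnK ?posrE // -expRN /cw.
  case: ifPn => [gw|_]; last first.
    have [a Aa] := A0; apply: le_trans (dist_pt_set_le nrm_norm x Aa) _.
    by rewrite oppr0 expR0 mulr1 XD //; exact: AX.
  have Aw : A (xw w) by exists w => //; apply: L0L; rewrite mem_filter gw.
  apply: le_trans (dist_pt_set_le nrm_norm x Aw) _.
  exact: (cell_diam hIFS p_stat E_lim XD pw wx (xwP _ pw)).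
apply: (le_trans le_int).
have istep : (\int[mu]_x (step m cw x)%:E)%E =
    (\sum_(w <- words N m.+1) wprob w * cw w)%:E.
  exact: (integral_step nrm_norm hIFS p_stat E_lim E_sep mu_gen).
rewrite integralB_EFin //=; last 2 first.
- exact: finite_measure_integrable_cst.
- apply/integrableP; split; first exact: mstep.
  under eq_integral => x _.
    rewrite gee0_abs; last by rewrite lee_fin step_ge0.
    over.
  by rewrite /= istep ltry.
rewrite istep integral_cst //= probability_setT mule1 -EFinB lee_fin.
rewrite -(sum_wprob_wsum p_stat).
suff : \sum_(w <- words N m.+1) wprob w * wsum chi w <=
    C1 * C / c + \sum_(w <- words N m.+1) wprob w * cw w by lra.
apply: le_trans (_ : \sum_(w <- words N m.+1) (wprob w * cw w) +
   \sum_(w <- words N m.+1 | dev w) wprob w * (C1 * m%:R) <= _).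
  rewrite [X in _ + X]big_mkcond -big_split /= !big_seq.
  apply: ler_sum => w wN; rewrite /cw /good.
  have sw : size w = m.+1 by apply/eqP; rewrite -mem_words.
  have wp := wprob_ge0 p_stat w.
  case: (dev w); rewrite ?andbF ?andbT.
    by rewrite mulr0 add0r ler_wpM2l // (wsum_le chiC sw).
  rewrite addr0; have [//|pw] := ltP 0 (wprob w).
  have -> : wprob w = 0 by apply/eqP; rewrite eq_le pw.
  by rewrite !mul0r.
rewrite addrC lerD2r -mulr_suml.
apply: le_trans (ler_wpM2r _ (LD m)) _; first by rewrite mulr_ge0.
(* Isolates [a * expR (- a)] with [a = c * m%:R], which is at most 1. *)
have -> : C * expR (- c * m%:R) * (C1 * m%:R) =
   C1 * C / c * ((c * m%:R) * expR (- (c * m%:R))).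
  by rewrite mulNr; field; exact: lt0r_neq0.
rewrite -[leRHS]mulr1 ler_wpM2l ?divr_ge0 ?mulr_ge0 ?(ltW c0) ?(ltW C0) //.
rewrite expRN ler_pdivrMr ?expR_gt0 // mul1r.
by have := expR_ge1Dx (c * m%:R); lra.
Qed.

Lemma sum_expR_le (a : R) n : 0 < a ->
  \sum_(0 <= l < n) expR (- a * l%:R) <= (1 - expR (- a))^-1.
Proof.
move=> a0; have q1 : expR (- a) < 1 by rewrite expR_lt1; lra.
suff -> : \sum_(0 <= l < n) expR (- a * l%:R) =
    (1 - expR (- a * n%:R)) / (1 - expR (- a)).
  rewrite -[leRHS]mul1r; apply: ler_wpM2r.
    by rewrite invr_ge0 subr_ge0 ltW.
  by rewrite gerBl expR_ge0.
elim: n => [|n IH]; first by rewrite big_nil mulr0 expR0 subrr mul0r.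
rewrite big_nat_recr //= IH -[n.+1%:R]natr1 mulrDr mulr1 expRD.
by field; rewrite subr_eq0 gt_eqF.
Qed.

Section close_words.
Variables (delta : R) (A : set 'rV[R]_k).
Hypothesis delta0 : 0 < delta.
Hypothesis sep :
  forall i j x y, i != j -> E i x -> E j y -> delta <= d x y.

(** The radius is half the separation of [cell_separated], so that one point [a] cannot serve two
    cells of the same generation. *)
Definition close w : bool := (0 < wprob w) && `[< exists a y,
  [/\ A a, cell w y & d y a < delta / 2 * expR (- wsum clo w)] >].

(** Choosing a nearby point of [A] for each close word is injective: if two words shared a point,
    the triangle inequality would put their cells closer than the average of the two separation
    bounds. *)
Lemma count_close n m : (A #<= `I_n)%card ->
  (size [seq w <- words N m.+1 | close w] <= n)%N.
Proof.
move=> /pcard_leP/unsquash phi.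
have /choice[f fP] : forall w, exists a, close w ->
    A a /\ exists2 y, cell w y & d y a < delta / 2 * expR (- wsum clo w).
  move=> w; have [cw|_] := boolP (close w); last by exists 0.
  by have /andP[_ /asboolP[a [y [Aa wy ya]]]] := cw; exists a => _; split => //; exists y.
pose L := [seq w <- words N m.+1 | close w].
have LP w : w \in L -> close w /\ size w = m.+1.
  by rewrite mem_filter => /andP[? ?]; split => //; apply/eqP; rewrite -mem_words.
have finj : {in L &, injective (phi \o f)}.
  move=> u v uL vL /= fuv; have [cu su] := LP u uL; have [cv sv] := LP v vL.
  have [Au [y uy yu]] := fP u cu; have [Av [z vz zv]] := fP v cv.
  have fE : f u = f v by apply: (inj _ _ fuv); rewrite inE.
  apply: contrapT => /eqP nuv.
  have /andP[pu _] := cu; have /andP[pv _] := cv.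
  have uv : size u = size v by rewrite su sv.
  have h1 := cell_separated hIFS p_stat E_lim (ltW delta0) sep nuv uv pu pv uy vz.
  rewrite eq_sym in nuv.
  have h2 := cell_separated hIFS p_stat E_lim (ltW delta0) sep nuv (esym uv)
    pv pu vz uy.
  have := nrm_dist_triangle nrm_norm (f u) y z.
  rewrite (nrm_distC nrm_norm (f u) z) fE in yu *.
  by rewrite (nrm_distC nrm_norm z y) in h2; lra.
have : uniq (map (phi \o f) L).
  by rewrite map_inj_in_uniq // filter_uniq // uniq_words.
move=> /uniq_leq_size h1.
rewrite -(size_map (phi \o f)) -[leqRHS](size_iota 0); apply: h1.
move=> _ /mapP[w wL ->]; rewrite mem_iota /= add0n.
have [cw _] := LP w wL; have [Aw _] := fP w cw.
by have := @funS _ _ _ _ phi _ Aw.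
Qed.

(** At most [n] words are close, and each that is typical has mass at most
    [expR (- (h - e) * m%:R)]; the atypical ones fall under the large deviation bound. *)
Lemma close_prob_le (e C c : R) n m : (A #<= `I_n)%card ->
  \sum_(w <- words N m.+1 | e * m%:R <= `|- ln (wprob w) - h * m%:R|)
      wprob w <= C * expR (- c * m%:R) ->
  \sum_(w <- words N m.+1) wprob w * (close w)%:R <=
    n%:R * expR (- (h - e) * m%:R) + C * expR (- c * m%:R).
Proof.
move=> An LD; apply: le_trans (lerD _ LD); last exact: lexx.
pose dev w := e * m%:R <= `|- ln (wprob w) - h * m%:R|.
apply: le_trans (_ : \sum_(w <- words N m.+1 | close w)
    expR (- (h - e) * m%:R) + \sum_(w <- words N m.+1 | dev w) wprob w <= _).
  rewrite [X in X + _]big_mkcond [X in _ + X]big_mkcond -big_split /=.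
  apply: ler_sum => w _; have wp := wprob_ge0 p_stat w.
  have [cw|_] := boolP (close w); last first.
    by rewrite mulr0 add0r; case: ifP.
  rewrite mulr1; case: ifPn => [_|]; first by rewrite lerDr expR_ge0.
  rewrite /dev -ltNge ltr_norml addr0 => /andP[hw _].
  have /andP[pw _] := cw.
  by rewrite -[leLHS]lnK ?posrE // ler_expR; lra.
rewrite lerD2r -big_filter big_const_seq count_predT iter_addr_0 -[leLHS]mulr_natr.
rewrite mulrC ler_wpM2r ?expR_ge0 // ler_nat; exact: count_close.
Qed.

End close_words.

(* At each generation l >= m a point of the quantizer is close to at most one
   cell, so the mass of points close to the quantizer is summable in l when
   n <= exp(Hm) and H is less than the entropy. *)
Lemma quant_error_lower (H : R) : 0 < H < h ->
  exists B : R, forall m n, (0 < n)%N -> ln (n%:R) <= H * m%:R ->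
    ((- (B + m%:R * \sum_i p i * clo i))%:E <= quant_error0 nrm mu n)%E.
Proof.
move=> /andP[H0 Hh]; pose e := (h - H) / 2; have e0 : 0 < e by rewrite /e; lra.
have [C [c [C0 c0 LD]]] := large_deviation p_stat e0.
have [delta /andP[d0 d1] sep] := limit_sets_separated nrm_norm E_lim E_sep.
pose C1 := \sum_i clo i.
have clo0 i : 0 < clo i by exact: (clo_gt0 hIFS).
have cloC i : clo i <= C1.
  by rewrite /C1 (bigD1 i) //= lerDl sumr_ge0 // => j _; exact/ltW.
have C10 : 0 < C1.
  have N0 : (0 < N)%N by rewrite (leq_trans _ (order_ge2 P)).
  exact: lt_le_trans (clo0 (Ordinal N0)) (cloC _).
pose a0 := - ln (delta / 2).
have a00 : 0 <= a0 by rewrite oppr_ge0 ln_le0 //; lra.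
(* Sum of the two geometric series that bound the masses of the close cells over all generations
   from [m] on. *)
pose B1 := (1 - expR (- e))^-1 + C * (1 - expR (- c))^-1.
exists (a0 + C1 * B1) => m n n0 nm.
apply: le_ereal_inf_tmp => _ [A [A0 An] <-].
have mstep := measurable_step nrm_norm hIFS p_stat E_lim E_sep.
have istep := integral_step nrm_norm hIFS p_stat E_lim E_sep mu_gen.
have stepE := step_cell nrm_norm hIFS p_stat E_lim E_sep.
pose cl w : R := (close delta A w)%:R.
have cl0 w : 0 <= cl w by rewrite /cl.
have clo_ge0 w : 0 <= wsum clo w by apply: wsum_ge0 => i; exact/ltW.
(* On the limit set, [T x] counts the generations from [m] on whose cell around [x] is close to the
   quantizer. *)
pose T x := (\sum_(0 <= l <oo) (step (m + l) cl x)%:E)%E.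
(* Majorant of minus the logarithmic distance: the scale of the generation [m] cell, plus at most
   [C1] for each close generation. *)
pose g x := (a0%:E + ((step m (wsum clo) x)%:E + C1%:E * T x))%E.
have T0 x : (0 <= T x)%E by apply: nneseries_ge0 => l _ _; rewrite lee_fin step_ge0.
have g0' x : (0 <= (step m (wsum clo) x)%:E + C1%:E * T x)%E.
  by rewrite adde_ge0 ?lee_fin ?step_ge0 // mule_ge0 // lee_fin ltW.
have g0 x : (0 <= g x)%E by rewrite adde_ge0 // lee_fin.
have mT : measurable_fun (setT : set (borel 'rV[R]_k)) T.
  rewrite (_ : T = fun x => (\sum_(0 <= l <oo | l \in xpredT)
      (step (m + l) cl x)%:E)%E); last first.
    by apply/funext => x; apply: eq_eseriesl.
  apply: ge0_emeasurable_sum => [l x _ _|l _]; last exact: mstep.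
  by rewrite lee_fin step_ge0.
have mg' : measurable_fun (setT : set (borel 'rV[R]_k))
    (fun x => ((step m (wsum clo) x)%:E + C1%:E * T x)%E).
  by apply: emeasurable_funD; [exact: mstep|exact: measurable_funeM].
have mg : measurable_fun (setT : set (borel 'rV[R]_k)) g.
  by apply: emeasurable_funD.
have int_g : (\int[mu]_x g x <=
    (a0 + (m%:R * \sum_i p i * clo i + C1 * B1))%:E)%E.
  rewrite /g ge0_integralD //=.
  rewrite integral_cst //= probability_setT mule1.
  rewrite EFinD leeD2l // ge0_integralD //=; last 3 first.
  - by move=> x _; rewrite lee_fin step_ge0.
  - by move=> x _; rewrite mule_ge0 // lee_fin ltW.
  - exact: measurable_funeM.
  rewrite istep // (sum_wprob_wsum p_stat) EFinD leeD2l //.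
  rewrite ge0_integralZl_EFin ?(ltW C10) //= EFinM.
  rewrite lee_wpmul2l ?lee_fin ?(ltW C10) //.
  rewrite /T integral_nneseries //=; last first.
  - by move=> l x _; rewrite lee_fin step_ge0.
  rewrite (eq_eseriesr (g := fun l =>
    (\sum_(w <- words N (m + l).+1) wprob w * cl w)%:E)); last first.
    by move=> l _; exact: istep.
  apply: lime_le.
    by apply: is_cvg_nneseries => l _ _; rewrite lee_fin sumr_ge0 // => w _;
      rewrite mulr_ge0 // wprob_ge0.
  near=> K; rewrite sumEFin lee_fin.
  (* Since [n] is at most [expR (H * (m + l)%:R)] and [h - e - H = e], the close typical words of
     generation [m + l] have mass at most [expR (- e * l%:R)]. *)
  apply: le_trans (_ : \sum_(0 <= l < K)
    (expR (- e * l%:R) + C * expR (- c * l%:R)) <= _).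
    apply: ler_sum => l _.
    apply: le_trans (close_prob_le d0 sep An (LD (m + l)%N)) _.
    have cl1 (a : R) : 0 < a -> expR (- a * (m + l)%:R) <= expR (- a * l%:R).
      by move=> ap; rewrite ler_expR !mulNr lerN2 ler_wpM2l ?(ltW ap) // ler_nat leq_addl.
    apply: lerD; last by rewrite ler_wpM2l ?(ltW C0) ?cl1.
    apply: le_trans (cl1 e e0).
    have nH : n%:R <= expR (H * (m + l)%:R).
      rewrite -[leLHS]lnK ?posrE ?ltr0n // ler_expR (le_trans nm) //.
      by rewrite ler_wpM2l ?(ltW H0) // ler_nat leq_addr.
    apply: le_trans (ler_wpM2r (expR_ge0 _) nH) _.
    by rewrite -expRD ler_expR -mulrDl ler_wpM2r // /e; lra.
  rewrite big_split /= -mulr_sumr; apply: lerD; first exact: sum_expR_le.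
  by rewrite ler_wpM2l ?(ltW C0) // sum_expR_le.
apply: (@le_trans _ _ (\int[mu]_x (- g x))%E).
  rewrite integral_ge0N //= EFinN leeN2 (le_trans int_g) // lee_fin; lra.
apply: (ae_le_integral (A := limit_set E)).
- exact: measurable_limit_setU E_lim.
- exact: (mu_limit_setC p_stat E_lim mu_gen).
- exact: measurableT_comp.
- exact: measurable_lne_dist.
move=> x [i _ Ex].
have [w [wN pw wx]] := cell_cover p_stat E_lim m Ex.
rewrite /g (stepE _ _ _ _ wN pw wx).
(* Refining the cell around [x] by [l] letters adds at most [C1] per letter to the exponent. *)
have W l : exists wl, [/\ wl \in words N (m + l).+1, 0 < wprob wl, cell wl x &
    wsum clo wl <= wsum clo w + C1 * l%:R].
  elim: l => [|l [[|j s] [vN pv vx vs]]].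
  - by exists w; rewrite addn0 mulr0 addr0.
  - by rewrite ltxx in pv.
  have [q Pq qx] := cell_ext E_lim vx.
  exists (rcons (j :: s) q); split => //.
  - move: vN; rewrite !mem_words size_rcons => /eqP ->.
    by rewrite addnS.
  - exact: (wprob_rcons_gt0 p_stat).
  rewrite wsum_rcons -[l.+1%:R]natr1 mulrDr mulr1 addrA.
  exact: lerD.
have stepW l v : v \in words N (m + l).+1 -> 0 < wprob v -> cell v x ->
    step (m + l) cl x = cl v.
  by move=> vN pv vx; rewrite (stepE _ _ _ _ vN pv vx).
have far v : ~~ close delta A v -> 0 < wprob v -> cell v x ->
    ((- (a0 + wsum clo v))%:E <= lne (dist_pt_set nrm x A)%:E)%E.
  rewrite /close => + pv vx; rewrite pv andTb => /asboolPn nc.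
  have far_pt a : A a -> delta / 2 * expR (- wsum clo v) <= d x a.
    by move=> Aa; rewrite leNgt; apply/negP => da; apply: nc; exists a, x.
  have fd := dist_pt_set_ge A0 far_pt.
  have rd : 0 < delta / 2 * expR (- wsum clo v).
    by rewrite mulr_gt0 ?expR_gt0 //; lra.
  rewrite lne_EFin ?(lt_le_trans rd) // lee_fin -ler_expR lnK; last first.
    by rewrite posrE (lt_le_trans rd).
  by apply: le_trans fd; rewrite opprD opprK expRD lnK // posrE; lra.
have partial K : (forall l, (l < K)%N -> step (m + l) cl x = 1) ->
    (K%:R%:E <= T x)%E.
  move=> s1; apply: le_trans (nneseries_lim_ge (m := 0) K _); last first.
    by move=> l _ _; rewrite lee_fin step_ge0.
  rewrite sumEFin lee_fin (eq_big_nat _ _ (F2 := fun=> 1)); last first.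
    by move=> l /andP[_ lK]; exact: s1.
  by rewrite sumr_const_nat subn0.
have [[l sl]|all1] := pselect (exists l, step (m + l) cl x != 1).
  (* At the first generation [m + K] that is not close, the distance to the quantizer is bounded
     below; the [K] earlier ones are all close, so [T x] is at least [K]. *)
  case: (ex_minnP (ex_intro (fun l => step (m + l) cl x != 1) l sl)) => K sK Kmin.
  have [v [vN pv vx vs]] := W K.
  have nc : ~~ close delta A v.
    by apply: contraNN sK => cv; rewrite (stepW K v) // /cl cv.
  apply: le_trans (far v nc pv vx).
  rewrite [leRHS]EFinN leeN2 EFinD leeD2l //.
  apply: (@le_trans _ _ (wsum clo w + C1 * K%:R)%:E); first by rewrite lee_fin.
  rewrite EFinD leeD2l // EFinM lee_wpmul2l ?lee_fin ?(ltW C10) //.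
  apply: partial => l' l'K; apply/eqP; apply: contraTT l'K => /Kmin.
  by rewrite -leqNgt.
(* If every generation is close, the lower bound degenerates to [-oo]. *)
have -> : T x = +oo%E.
  apply/eqyP => r r0; apply: le_trans (partial (Num.truncn r).+1 _).
    by rewrite lee_fin ltW // truncnS_gt.
  by move=> l _; apply: contrapT => /eqP sl; apply: all1; exists l.
by rewrite gt0_muley ?lte_fin // ?addey //= ?leNye.
Unshelve. all: by end_near.
Qed.

End quantization_bounds.

(** * Eventual bounds for upper and lower limits *)

Lemma limn_esup_le (R : realType) (u : nat -> \bar R) (l : \bar R) :
  (exists n0, forall n, (n0 <= n)%N -> (u n <= l)%E) -> (limn_esup u <= l)%E.
Proof.
move=> [n0 ul]; rewrite /limn_esup limf_esupE.
apply: (@le_trans _ _ (ereal_sup [set u n | n in [set n | (n0 <= n)%N]])).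
  apply: ereal_inf_lbound; exists [set n | (n0 <= n)%N] => //.
  by exists n0.
by apply: ge_ereal_sup => _ [n /ul un <-].
Qed.

Lemma limn_einf_ge (R : realType) (u : nat -> \bar R) (l : \bar R) :
  (exists n0, forall n, (n0 <= n)%N -> (l <= u n)%E) -> (l <= limn_einf u)%E.
Proof.
move=> [n0 lu]; rewrite /limn_einf leeNr; apply: limn_esup_le.
by exists n0 => n /lu; rewrite leeN2.
Qed.

Lemma ln_natr_ge (R : realType) (K : R) :
  exists n0, forall n, (n0 <= n)%N -> (0 < n)%N /\ K <= ln (n%:R : R).
Proof.
exists (Num.truncn (expR K)).+1 => n n0n.
have n0 : (0 < n)%N by exact: leq_trans n0n.
split=> //; rewrite -[K]expRK ler_ln ?posrE ?expR_gt0 ?ltr0n //.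
by rewrite (le_trans (ltW (truncnS_gt _))) // ler_nat.
Qed.

(** * From error bounds to dimension bounds *)

Section dimension.
Variables (R : realType) (k N : nat) (nrm : 'rV[R]_k -> R).
Variables (P : irr_stochastic R N) (X : set 'rV[R]_k).
Variables (S : 'I_N -> 'rV[R]_k -> 'rV[R]_k) (slo shi : 'I_N -> R).
Variables (p : 'I_N -> R) (E : 'I_N -> set 'rV[R]_k).
Variable mu : probability (borel 'rV[R]_k) R.
Hypotheses (nrm_norm : is_norm nrm).
Hypotheses (hIFS : hyperbolic_recurrent_IFS nrm X S slo shi).
Hypotheses (p_stat : stationary P p) (E_lim : limit_sets P X S E).
Hypotheses (E_sep : strong_separation nrm P S E).
Hypotheses (mu_gen : generated_measure P S p E mu).
Let h := entropy P p.
Let xlo := \sum_i p i * clo slo i.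
Let xhi := \sum_i p i * chi shi i.

Let h_ge0 : 0 <= h. Proof. exact: entropy_ge0. Qed.

Lemma sum_stat_gt0 (f : 'I_N -> R) : (forall i, 0 < f i) ->
  0 < \sum_i p i * f i.
Proof.
move=> f0; have N0 : (0 < N)%N by rewrite (leq_trans _ (order_ge2 P)).
rewrite (bigD1 (Ordinal N0)) //= ltr_pwDl ?mulr_gt0 ?(stat_gt0 p_stat) //.
by rewrite sumr_ge0 // => i _; rewrite mulr_ge0 // ltW ?(stat_gt0 p_stat).
Qed.

Let xlo_gt0 : 0 < xlo.
Proof. by apply: sum_stat_gt0 => i; exact: (clo_gt0 hIFS). Qed.

Let xhi_gt0 : 0 < xhi.
Proof. by apply: sum_stat_gt0 => i; exact: (chi_gt0 hIFS). Qed.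

(** Take [m] to be the integer part of [ln n%:R / H]. The slack [xhi - x] absorbs both the constant
    [B] and the rounding once [n] is large. *)
Lemma quant_error_le_ln (H x : R) : h < H -> x < xhi ->
  exists n0, forall n, (n0 <= n)%N -> 0 < ln (n%:R : R) /\
    (quant_error0 nrm mu n <= (- (x * (ln n%:R / H)))%:E)%E.
Proof.
move=> hH xx; have H0 : 0 < H by exact: le_lt_trans hH.
have [B BP] := quant_error_upper nrm_norm hIFS p_stat E_lim E_sep mu_gen hH.
have [n0 nP] := ln_natr_ge (Num.max 1 (H * ((B + xhi) / (xhi - x)))).
exists n0 => n /nP[n1]; rewrite ge_max => /andP[ln1 lnB].
split; first lra.
have l0 : 0 <= ln n%:R / H by rewrite divr_ge0 //; lra.
have /andP[m1 m2] := truncn_itv l0; set m := Num.truncn _ in m1 m2.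
have Hm : H * m%:R <= ln (n%:R : R) by rewrite mulrC -ler_pdivlMr.
apply: (le_trans (BP m n n1 Hm)); rewrite lee_fin -/xhi.
have : (B + xhi) / (xhi - x) <= ln n%:R / H by rewrite ler_pdivlMr // mulrC.
rewrite ler_pdivrMr ?subr_gt0 // => h1.
have : (ln n%:R / H) * xhi <= (m%:R + 1) * xhi.
  by rewrite ler_wpM2r ?(ltW xhi_gt0) // natr1 ltW.
lra.
Qed.

Lemma quant_error_ge_ln (H x : R) : 0 < H < h -> xlo < x ->
  exists n0, forall n, (n0 <= n)%N ->
    ((- (x * (ln n%:R / H)))%:E <= quant_error0 nrm mu n)%E.
Proof.
move=> /[dup] /andP[H0 _] Hh xx.
have [B BP] := quant_error_lower nrm_norm hIFS p_stat E_lim E_sep mu_gen Hh.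
have [n0 nP] := ln_natr_ge (Num.max 1 (H * ((B + xlo) / (x - xlo)))).
exists n0 => n /nP[n1]; rewrite ge_max => /andP[ln1 lnB].
have l0 : 0 <= ln n%:R / H by rewrite divr_ge0 //; lra.
have /andP[m1 m2] := truncn_itv l0; set m := Num.truncn _ in m1 m2.
have Hm : ln (n%:R : R) <= H * m.+1%:R by rewrite mulrC -ler_pdivrMr // ltW.
(* The lower bound needs [ln n%:R <= H * m%:R], so the quotient is rounded up here. *)
apply: le_trans (BP m.+1 n n1 Hm); rewrite lee_fin lerN2 -/xlo.
have : (B + xlo) / (x - xlo) <= ln n%:R / H by rewrite ler_pdivlMr // mulrC.
rewrite ler_pdivrMr ?subr_gt0 // => h1.
have : m%:R * xlo <= (ln n%:R / H) * xlo by rewrite ler_wpM2r ?(ltW xlo_gt0).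
rewrite -natr1; lra.
Qed.

Lemma quant_ratio_le (L : R) : h / xhi < L ->
  exists n0, forall n, (n0 <= n)%N -> (quant_ratio0 nrm mu n <= L%:E)%E.
Proof.
rewrite ltr_pdivrMr // => hL.
have L0 : 0 < L by rewrite -(pmulr_lgt0 _ xhi_gt0) (le_lt_trans h_ge0).
(* A midpoint, so that [h < H] and [H / L < xhi]; with [x = H / L] the error bound is exactly
   [- ln n%:R / L]. *)
pose H := (h + L * xhi) / 2.
have hH : h < H by rewrite /H; lra.
have H0 : 0 < H by exact: le_lt_trans hH.
have xx : H / L < xhi by rewrite ltr_pdivrMr // /H mulrC; lra.
have [n0 nP] := quant_error_le_ln hH xx.
exists n0 => n /nP[ln0 en]; rewrite /quant_ratio0.
have a0 : 0 < H / L * (ln n%:R / H) by apply: mulr_gt0; exact: divr_gt0.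
have ae : ((H / L * (ln n%:R / H))%:E <= - quant_error0 nrm mu n)%E.
  by rewrite leeNr -EFinN.
have -> : L = ln n%:R * (H / L * (ln n%:R / H))^-1.
  by field; rewrite !gt_eqF.
rewrite EFinM lee_wpmul2l ?lee_fin ?(ltW ln0) //.
have -> : ((H / L * (ln n%:R / H))^-1)%:E = ((H / L * (ln n%:R / H))%:E)^-1%E.
  by rewrite inver gt_eqF.
rewrite lee_pV2 // inE ?lee_fin ?(ltW a0) //.
by apply: le_trans ae; rewrite lee_fin ltW.
Qed.

Lemma quant_ratio_ge0 :
  exists n0, forall n, (n0 <= n)%N -> (0 <= quant_ratio0 nrm mu n)%E.
Proof.
have h1 : h < h + 1 by rewrite ltrDl.
have [n0 nP] := quant_error_le_ln h1 xhi_gt0.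
exists n0 => n /nP[ln0]; rewrite mul0r oppr0 => en.
by rewrite mule_ge0 ?lee_fin ?(ltW ln0) // inve_ge0 oppe_ge0.
Qed.

Lemma quant_ratio_ge (L : R) : L < h / xlo ->
  exists n0, forall n, (n0 <= n)%N -> (L%:E <= quant_ratio0 nrm mu n)%E.
Proof.
(* Nonpositive [L] also covers zero entropy; a positive [L] forces [0 < h], as the lower error bound
   requires. *)
have [L0|L0] := leP L 0.
  move=> _; have [n0 nP] := quant_ratio_ge0.
  by exists n0 => n /nP; apply: le_trans; rewrite lee_fin.
rewrite ltr_pdivlMr // => hL.
pose H := (h + L * xlo) / 2.
have Lx : 0 < L * xlo by rewrite mulr_gt0.
have hH : 0 < H < h by rewrite /H; lra.
have /andP[H0 _] := hH.
have xx : xlo < H / L by rewrite ltr_pdivlMr // /H mulrC; lra.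
have [n0 nP] := quant_error_ge_ln hH xx.
have h1 : h < h + 1 by rewrite ltrDl.
(* Taking [x = 0] makes the error eventually nonpositive, which inverting the inequality between
   extended reals requires. *)
have [n1 nP1] := quant_error_le_ln h1 xhi_gt0.
exists (maxn n0 n1) => n; rewrite geq_max => /andP[/nP en /nP1[ln0]].
rewrite mul0r oppr0 => en0; rewrite /quant_ratio0.
have a0 : 0 < H / L * (ln n%:R / H) by apply: mulr_gt0; exact: divr_gt0.
have ae : (- quant_error0 nrm mu n <= (H / L * (ln n%:R / H))%:E)%E.
  by rewrite leeNl -EFinN.
have -> : L = ln n%:R * (H / L * (ln n%:R / H))^-1.
  by field; rewrite !gt_eqF.
rewrite EFinM lee_wpmul2l ?lee_fin ?(ltW ln0) //.
have -> : ((H / L * (ln n%:R / H))^-1)%:E = ((H / L * (ln n%:R / H))%:E)^-1%E.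
  by rewrite inver gt_eqF.
by rewrite lee_pV2 // inE ?lee_fin ?(ltW a0) // oppe_ge0.
Qed.

End dimension.

Theorem theorem3p2 (R : realType) (k N : nat) (nrm : 'rV[R]_k -> R)
  (P : irr_stochastic R N) (X : set 'rV[R]_k)
  (S : 'I_N -> 'rV[R]_k -> 'rV[R]_k) (slo shi : 'I_N -> R)
  (p : 'I_N -> R) (E : 'I_N -> set 'rV[R]_k)
  (mu : probability (borel 'rV[R]_k) R)
  (nrm_norm : is_norm nrm)
  (hIFS : hyperbolic_recurrent_IFS nrm X S slo shi)
  (p_stat : stationary P p)
  (E_lim : limit_sets P X S E)
  (E_sep : strong_separation nrm P S E)
  (mu_gen : generated_measure P S p E mu) :
  [/\ (((\sum_(i < N) \sum_(j < N) p i * P i j * ln (P i j)) /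
        (\sum_(i < N) p i * ln (slo i)))%:E <= lower_quant_dim0 nrm mu)%E,
      (lower_quant_dim0 nrm mu <= upper_quant_dim0 nrm mu)%E &
      (upper_quant_dim0 nrm mu <=
       ((\sum_(i < N) \sum_(j < N) p i * P i j * ln (P i j)) /
        (\sum_(i < N) p i * ln (shi i)))%:E)%E].
Proof.
have ratioE (s : 'I_N -> R) :
    (\sum_(i < N) \sum_(j < N) p i * P i j * ln (P i j)) /
    (\sum_(i < N) p i * ln (s i)) =
    entropy P p / \sum_i p i * - ln (s i).
  under [in RHS]eq_bigr do rewrite mulrN.
  by rewrite sumrN /entropy invrN mulrNN.
rewrite !ratioE; split; last 1 first.
- apply/lee_addgt0Pr => e e0; rewrite -EFinD; apply: limn_esup_le.
  apply: (quant_ratio_le nrm_norm hIFS p_stat E_lim E_sep mu_gen).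
  by rewrite ltrDl.
- apply/lee_addgt0Pr => e e0; rewrite -leeBlDr // -EFinB.
  apply: limn_einf_ge.
  apply: (quant_ratio_ge nrm_norm hIFS p_stat E_lim E_sep mu_gen).
  by rewrite ltrBlDr ltrDl.
- exact: limn_einf_sup.
Qed.
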